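(* Let $\mathcal{EF}$ be the category of the equivalential Frobenius monad freely generated by a single object, let $\mathcal{EF}_{\mathrm H}$ be the syntactically defined category described in the context, and let $\mathit{Gen}$ be the category of split equivalences between finite ordinals. The categories $\mathcal{EF}$, $\mathcal{EF}_{\mathrm H}$ and $\mathit{Gen}$ are isomorphic.
   Context: Notation: $\circ$ is composition of arrows; $\mathbf 1$ denotes identity arrows; for a natural transformation $\theta$ and functors $F,M$, $\theta_F$ has components $\theta_{Fa}$ and $M\theta$ has components $M(\theta_a)$. Finite ordinals are $n=\{0,\dots,n-1\}$. **Gen.** For a finite ordinal $n$ and a number $i$ write $n_i=n\times\{i\}$. A split equivalence from $n$ to $m$ is an equivalence relation on the set $n_1\cup m_2$ (the disjoint union of source $n$ and target $m$). $\mathit{Gen}$ has the finite ordinals as objects and the split equivalences from $n$ to $m$ as arrows $n\to m$. The identity on $n$ is $\{((a,i),(a,j)) : a\in n,\ i,j\in\{1,2\}\}$. The composition $Q\circ P$ of $P$ from $n$ to $m$ and $Q$ from $m$ to $k$ is obtained by relabelling the target copy of $m$ in $P$ and the source copy of $m$ in $Q$ both as $m_3$, taking the transitive closure of the union of the two relations, and deleting all pairs in which an element of $m_3$ occurs. **Equivalential Frobenius monad.** This is a category $\mathcal A$ with an endofunctor $M$ and natural transformations $\nabla:MM\to M$, $\Delta:M\to MM$, $u:I\to M$, $\varepsilon:M\to I$, $\tau:MM\to MM$ ($I$ the identity functor) satisfying the following. Monad: $\nabla\circ\nabla_M=\nabla\circ M\nabla$, $\nabla\circ u_M=\mathbf 1_M=\nabla\circ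 Mu$. Comonad: $\Delta_M\circ\Delta=M\Delta\circ\Delta$, $\varepsilon_M\circ\Delta=\mathbf 1_M=M\varepsilon\circ\Delta$. Frobenius: $M\nabla\circ\Delta_M=\Delta\circ\nabla=\nabla_M\circ M\Delta$. Symmetry: $\tau\circ\tau=\mathbf 1_{MM}$, $M\tau\circ\tau_M\circ M\tau=\tau_M\circ M\tau\circ\tau_M$, $\nabla\circ\tau=\nabla$, $\tau\circ\Delta=\Delta$, $\tau\circ\nabla_M=M\nabla\circ\tau_M\circ M\tau$, $\Delta_M\circ\tau=M\tau\circ\tau_M\circ M\Delta$, $\tau\circ u_M=Mu$, $\varepsilon_M\circ\tau=M\varepsilon$. Separability: $\nabla\circ\Delta=\mathbf 1_M$. Unit-counit homomorphism: $\varepsilon\circ u=\mathbf 1_I$. **EF.** $\mathcal{EF}$ is the free equivalential Frobenius monad on one object $0$: its objects are $M^n0$, identified with $n\ge 0$; its arrow terms are built from the components at all objects $n$ of the natural transformations $\nabla,\Delta,u,\varepsilon,\tau$ and from identities, by composition and by applying $M$; its arrows are the equivalence classes of arrow terms under the least congruence (for composition and $M$) validating the category axioms, functoriality of $M$, naturality of $\nabla,\Delta,u,\varepsilon,\tau$, and, at all objects, all the equations required in the definition of an equivalential Frobenius monad (the monad, comonad, Frobenius, symmetry, separability and unit-counit homomorphism equations). **$\mathcal{EF}_{\mathrm H}$.** Objects: finite ordinals. Primitive arrow terms, for all $n,m\ge0$: ${}_n\mathbf 1_m:n+m\to n+m$; ${}_nu_m:n+m\to n+1+m$; ${}_n\varepsilon_m:n+1+m\to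 n+m$; ${}_n\tau_m:n+2+m\to n+2+m$; ${}_n\bar{\mathrm H}_m:n+2+m\to n+2+m$. Arrow terms are closed under composition of terms of matching type (parentheses are not written, so composition is associative). Set ${}_n({}_k\theta_l)_m={}_{n+k}\theta_{l+m}$ for primitive $\theta$, and ${}_n(g\circ f)_m={}_ng_m\circ{}_nf_m$; a subscript $0$ is omitted. Arrows are equivalence classes of arrow terms under the least equivalence relation (between terms of the same type) closed under the rules ''if $f=g$ then ${}_nf_m={}_ng_m$'' and ''if $f=g$ and $f'=g'$ then $f'\circ f=g'\circ g$'' and containing: - $f\circ\mathbf 1_n=f=\mathbf 1_m\circ f$ for $f:n\to m$; ${}_1\mathbf 1=\mathbf 1_1$; - ${}_{q+r}\theta\circ\xi_{r+k}=\xi_{r+l}\circ{}_{p+r}\theta$ for $\xi:p\to q$, $\theta:k\to l$ in $\{u,\varepsilon,\tau,\bar{\mathrm H}\}$, $r\ge0$; - $\tau\circ\tau=\mathbf 1_2$; ${}_1\tau\circ\tau_1\circ{}_1\tau=\tau_1\circ{}_1\tau\circ\tau_1$; $\tau\circ u_1={}_1u$; $\varepsilon_1\circ\tau={}_1\varepsilon$; - $\varepsilon\circ u=\mathbf 1$ (identity of $0$); - $\bar{\mathrm H}\circ\bar{\mathrm H}=\bar{\mathrm H}$; ${}_1\tau\circ\bar{\mathrm H}_1\circ{}_1\tau=\tau_1\circ{}_1\bar{\mathrm H}\circ\tau_1$; $\tau\circ\bar{\mathrm H}=\bar{\mathrm H}=\bar{\mathrm H}\circ\tau$; - $\varepsilon_1\circ\bar{\mathrm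 H}\circ u_1=\mathbf 1_1$ (or, alternatively, ${}_1\varepsilon\circ\bar{\mathrm H}\circ{}_1u=\mathbf 1_1$); - ${}_1\bar{\mathrm H}\circ\bar{\mathrm H}_1=\bar{\mathrm H}_1\circ{}_1\bar{\mathrm H}$. *)

(* Defs.v *)
From mathcomp Require Import all_boot.
From mathcomp Require Import boolp.

Set Implicit Arguments.
Unset Strict Implicit.
Unset Printing Implicit Defensive.

Record category := Category {
  obj : Type;
  hom : obj -> obj -> Type;
  idm : forall a, hom a a;
  cmp : forall a b c, hom b c -> hom a b -> hom a c;
  cmp1m : forall a b (f : hom a b), cmp (idm b) f = f;
  cmpm1 : forall a b (f : hom a b), cmp f (idm a) = f;
  cmpA : forall a b c d (h : hom c d) (g : hom b c) (f : hom a b),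
    cmp h (cmp g f) = cmp (cmp h g) f
}.
Arguments idm : clear implicits.

Record functor (C D : category) := Functor {
  fobj : obj C -> obj D;
  fmap : forall a b, hom a b -> hom (fobj a) (fobj b);
  fmap1 : forall a, fmap (idm C a) = idm D (fobj a);
  fmapM : forall a b c (g : hom b c) (f : hom a b),
    fmap (cmp g f) = cmp (fmap g) (fmap f)
}.

Definition functor_id (C : category) : functor C C :=
  @Functor C C id (fun _ _ f => f) (fun _ => erefl) (fun _ _ _ _ _ => erefl).

Lemma functor_comp1 (C D E : category) (G : functor D E) (F : functor C D) a :
  fmap G (fmap F (idm C a)) = idm E (fobj G (fobj F a)).
Proof. by rewrite !fmap1. Qed.

Lemma functor_compM (C D E : category) (G : functor D E) (F : functor C D)
    a b c (g : hom b c) (f : hom a b) :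
  fmap G (fmap F (cmp g f)) = cmp (fmap G (fmap F g)) (fmap G (fmap F f)).
Proof. by rewrite !fmapM. Qed.

Definition functor_comp (C D E : category) (G : functor D E) (F : functor C D) :
    functor C E :=
  @Functor C E (fun a => fobj G (fobj F a)) (fun _ _ f => fmap G (fmap F f))
    (functor_comp1 G F) (functor_compM G F).

(* Equality of functors is Leibniz equality of the records; as the laws are
   proofs, it is equality on objects and on arrows. *)
Definition isomorphic (C D : category) : Prop :=
  exists (F : functor C D) (G : functor D C),
    functor_comp G F = functor_id C /\ functor_comp F G = functor_id D.

Definition quotient (T : Type) (R : T -> T -> Prop) : Type :=
  {C : T -> Prop | exists t, C = R t}.

Definition class (T : Type) (R : T -> T -> Prop) (t : T) : quotient R :=
  exist _ (R t) (ex_intro _ t erefl).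

Definition repr (T : Type) (R : T -> T -> Prop) (q : quotient R) : T :=
  projT1 (cid (proj2_sig q)).

Lemma reprK (T : Type) (R : T -> T -> Prop) (q : quotient R) :
  class R (repr q) = q.
Proof.
rewrite /repr; case: q => C hC /=; case: cid => t /= Ct.
by subst C; congr exist; exact: Prop_irrelevance.
Qed.

Record presentation := Presentation {
  pobj : Type;
  term : pobj -> pobj -> Type;
  teq : forall a b, term a b -> term a b -> Prop;
  tid : forall a, term a a;
  tcmp : forall a b c, term b c -> term a b -> term a c;
  teq_refl : forall a b (f : term a b), teq f f;
  teq_sym : forall a b (f g : term a b), teq f g -> teq g f;
  teq_trans : forall a b (f g h : term a b), teq f g -> teq g h -> teq f h;
  teq_cmp : forall a b c (g g' : term b c) (f f' : term a b),
    teq g g' -> teq f f' -> teq (tcmp g f) (tcmp g' f');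
  teq_1m : forall a b (f : term a b), teq (tcmp (tid b) f) f;
  teq_m1 : forall a b (f : term a b), teq (tcmp f (tid a)) f;
  teq_A : forall a b c d (h : term c d) (g : term b c) (f : term a b),
    teq (tcmp h (tcmp g f)) (tcmp (tcmp h g) f)
}.
Arguments tid : clear implicits.

Definition arrow (S : presentation) (a b : pobj S) : Type :=
  quotient (@teq S a b).

Definition arrow_of (S : presentation) (a b : pobj S) (f : term a b) :
  arrow a b := class (@teq S a b) f.

Lemma arrow_ofP (S : presentation) (a b : pobj S) (f g : term a b) :
  arrow_of f = arrow_of g <-> teq f g.
Proof.
split=> [[/(congr1 (fun C => C g)) ->]|fg]; first exact: teq_refl.
rewrite /arrow_of /class; have e : teq f = teq g.
  apply/funext => h; apply/propext; split=> H.
    exact: teq_trans (teq_sym fg) H.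
  exact: teq_trans fg H.
move: (ex_intro _ f _) (ex_intro _ g _); rewrite e => p q.
by congr exist; exact: Prop_irrelevance.
Qed.

(* Composition does not depend on the representatives: see [arrow_cmpE]. *)
Definition arrow_cmp (S : presentation) (a b c : pobj S)
    (g : arrow b c) (f : arrow a b) : arrow a c :=
  arrow_of (tcmp (repr g) (repr f)).

Lemma arrow_cmpE (S : presentation) (a b c : pobj S)
    (g : term b c) (f : term a b) :
  arrow_cmp (arrow_of g) (arrow_of f) = arrow_of (tcmp g f).
Proof.
by apply/arrow_ofP; apply: teq_cmp; apply/arrow_ofP; exact: reprK.
Qed.

Lemma arrow_cmp1m (S : presentation) (a b : pobj S) (f : arrow a b) :
  arrow_cmp (arrow_of (tid S b)) f = f.
Proof.
by rewrite -(reprK f) arrow_cmpE; apply/arrow_ofP; exact: teq_1m.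
Qed.

Lemma arrow_cmpm1 (S : presentation) (a b : pobj S) (f : arrow a b) :
  arrow_cmp f (arrow_of (tid S a)) = f.
Proof.
by rewrite -(reprK f) arrow_cmpE; apply/arrow_ofP; exact: teq_m1.
Qed.

Lemma arrow_cmpA (S : presentation) (a b c d : pobj S)
    (h : arrow c d) (g : arrow b c) (f : arrow a b) :
  arrow_cmp h (arrow_cmp g f) = arrow_cmp (arrow_cmp h g) f.
Proof.
rewrite -(reprK f) -(reprK g) -(reprK h).
move: (repr f) (repr g) (repr h) => {}f {}g {}h.
by rewrite (arrow_cmpE g f) (arrow_cmpE h g) !arrow_cmpE; apply/arrow_ofP/teq_A.
Qed.

Definition presented (S : presentation) : category :=
  @Category (pobj S) (@arrow S) (fun a => arrow_of (tid S a)) (@arrow_cmp S)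
    (@arrow_cmp1m S) (@arrow_cmpm1 S) (@arrow_cmpA S).

(* The object [M^n 0] is [n], so [M] acts on objects as the successor. *)
Inductive ef_term : nat -> nat -> Type :=
| ef_id n : ef_term n n
| ef_nabla n : ef_term n.+2 n.+1
| ef_Delta n : ef_term n.+1 n.+2
| ef_u n : ef_term n n.+1
| ef_eps n : ef_term n.+1 n
| ef_tau n : ef_term n.+2 n.+2
| ef_comp n m k : ef_term m k -> ef_term n m -> ef_term n k
| ef_M n m : ef_term n m -> ef_term n.+1 m.+1.

Declare Scope ef_scope.
Delimit Scope ef_scope with ef.
Bind Scope ef_scope with ef_term.
Notation "g ∘ f" := (ef_comp g f) (at level 40, left associativity) : ef_scope.
Notation "∇ n" := (ef_nabla n) (at level 9, n at level 9) : ef_scope.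
Notation "'Δ' n" := (ef_Delta n) (at level 9, n at level 9) : ef_scope.
Notation "'υ' n" := (ef_u n) (at level 9, n at level 9) : ef_scope.
Notation "'ε' n" := (ef_eps n) (at level 9, n at level 9) : ef_scope.
Notation "'τ' n" := (ef_tau n) (at level 9, n at level 9) : ef_scope.

Reserved Notation "f ≈ g" (at level 70, no associativity).

(* At the object [n], the component of [theta_M] is [theta n.+1] and that of
   [M theta] is [ef_M (theta n)]. *)
Inductive ef_eq : forall n m, ef_term n m -> ef_term n m -> Prop :=
| ef_refl n m (f : ef_term n m) : f ≈ f
| ef_sym n m (f g : ef_term n m) : f ≈ g -> g ≈ f
| ef_trans n m (f g h : ef_term n m) : f ≈ g -> g ≈ h -> f ≈ h
| ef_comp_congr n m k (g g' : ef_term m k) (f f' : ef_term n m) :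
    g ≈ g' -> f ≈ f' -> g ∘ f ≈ g' ∘ f'
| ef_M_congr n m (f g : ef_term n m) : f ≈ g -> ef_M f ≈ ef_M g
| ef_id_comp n m (f : ef_term n m) : ef_id m ∘ f ≈ f
| ef_comp_id n m (f : ef_term n m) : f ∘ ef_id n ≈ f
| ef_compA n m k l (h : ef_term k l) (g : ef_term m k) (f : ef_term n m) :
    h ∘ (g ∘ f) ≈ (h ∘ g) ∘ f
| ef_M_id n : ef_M (ef_id n) ≈ ef_id n.+1
| ef_M_comp n m k (g : ef_term m k) (f : ef_term n m) :
    ef_M (g ∘ f) ≈ ef_M g ∘ ef_M f
| ef_nabla_nat n m (f : ef_term n m) : ∇ m ∘ ef_M (ef_M f) ≈ ef_M f ∘ ∇ n
| ef_Delta_nat n m (f : ef_term n m) : Δ m ∘ ef_M f ≈ ef_M (ef_M f) ∘ Δ n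
| ef_u_nat n m (f : ef_term n m) : υ m ∘ f ≈ ef_M f ∘ υ n
| ef_eps_nat n m (f : ef_term n m) : ε m ∘ ef_M f ≈ f ∘ ε n
| ef_tau_nat n m (f : ef_term n m) :
    τ m ∘ ef_M (ef_M f) ≈ ef_M (ef_M f) ∘ τ n
| ef_nablaA n : ∇ n ∘ ∇ n.+1 ≈ ∇ n ∘ ef_M (∇ n)
| ef_nabla_uM n : ∇ n ∘ υ n.+1 ≈ ef_id n.+1
| ef_nabla_Mu n : ∇ n ∘ ef_M (υ n) ≈ ef_id n.+1
| ef_DeltaA n : Δ n.+1 ∘ Δ n ≈ ef_M (Δ n) ∘ Δ n
| ef_epsM_Delta n : ε n.+1 ∘ Δ n ≈ ef_id n.+1
| ef_Meps_Delta n : ef_M (ε n) ∘ Δ n ≈ ef_id n.+1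
| ef_frob_l n : ef_M (∇ n) ∘ Δ n.+1 ≈ Δ n ∘ ∇ n
| ef_frob_r n : Δ n ∘ ∇ n ≈ ∇ n.+1 ∘ ef_M (Δ n)
| ef_tau_tau n : τ n ∘ τ n ≈ ef_id n.+2
| ef_tau_braid n :
    ef_M (τ n) ∘ τ n.+1 ∘ ef_M (τ n) ≈ τ n.+1 ∘ ef_M (τ n) ∘ τ n.+1
| ef_nabla_tau n : ∇ n ∘ τ n ≈ ∇ n
| ef_tau_Delta n : τ n ∘ Δ n ≈ Δ n
| ef_tau_nablaM n : τ n ∘ ∇ n.+1 ≈ ef_M (∇ n) ∘ τ n.+1 ∘ ef_M (τ n)
| ef_DeltaM_tau n : Δ n.+1 ∘ τ n ≈ ef_M (τ n) ∘ τ n.+1 ∘ ef_M (Δ n)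
| ef_tau_uM n : τ n ∘ υ n.+1 ≈ ef_M (υ n)
| ef_epsM_tau n : ε n.+1 ∘ τ n ≈ ef_M (ε n)
| ef_nabla_Delta n : ∇ n ∘ Δ n ≈ ef_id n.+1
| ef_eps_u n : ε n ∘ υ n ≈ ef_id n
where "f ≈ g" := (ef_eq f%ef g%ef).

Definition EF_presentation : presentation :=
  @Presentation nat ef_term ef_eq ef_id ef_comp ef_refl ef_sym ef_trans
    ef_comp_congr ef_id_comp ef_comp_id ef_compA.

Definition EF : category := presented EF_presentation.

Inductive eh_gen := Hone | Hu | Heps | Htau | Hbar.

Definition eh_src (th : eh_gen) : nat :=
  match th with Hone => 0 | Hu => 0 | Heps => 1 | Htau => 2 | Hbar => 2 end.

Definition eh_tgt (th : eh_gen) : nat :=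
  match th with Hone => 0 | Hu => 1 | Heps => 0 | Htau => 2 | Hbar => 2 end.

(* Terms are untyped, so that shifting subscripts involves no transport along
   equations between natural numbers; [eh_typed] selects the arrow terms.
   [eh_prim n th m] is the primitive term with left subscript [n] and right
   subscript [m]. *)
Inductive eh_term :=
| eh_prim (n : nat) (th : eh_gen) (m : nat)
| eh_comp (g f : eh_term).

Declare Scope eh_scope.
Delimit Scope eh_scope with eh.
Bind Scope eh_scope with eh_term.
Notation "g ∘ f" := (eh_comp g f) (at level 40, left associativity) : eh_scope.

Inductive eh_typed : nat -> nat -> eh_term -> Prop :=
| typed_prim n th m :
    eh_typed (n + eh_src th + m) (n + eh_tgt th + m) (eh_prim n th m)
| typed_comp a b c g f :
    eh_typed b c g -> eh_typed a b f -> eh_typed a c (eh_comp g f).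

Definition eh_id (n : nat) : eh_term := eh_prim 0 Hone n.

Fixpoint eh_shift (n : nat) (f : eh_term) (m : nat) : eh_term :=
  match f with
  | eh_prim k th l => eh_prim (n + k) th (l + m)
  | eh_comp g f => eh_comp (eh_shift n g m) (eh_shift n f m)
  end.

Reserved Notation "f ≈ g :> a ⇒ b"
  (at level 70, g at next level, a at next level, b at next level).

(* Only terms of type [a -> b] are related: see [eh_eq_typed]. *)
Inductive eh_eq : nat -> nat -> eh_term -> eh_term -> Prop :=
| eh_refl a b f : eh_typed a b f -> f ≈ f :> a ⇒ b
| eh_sym a b f g : f ≈ g :> a ⇒ b -> g ≈ f :> a ⇒ b
| eh_trans a b f g h :
    f ≈ g :> a ⇒ b -> g ≈ h :> a ⇒ b -> f ≈ h :> a ⇒ b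
| eh_comp_congr a b c g g' f f' :
    g ≈ g' :> b ⇒ c -> f ≈ f' :> a ⇒ b -> g ∘ f ≈ g' ∘ f' :> a ⇒ c
| eh_shift_congr n m a b f g :
    f ≈ g :> a ⇒ b ->
    eh_shift n f m ≈ eh_shift n g m :> (n + a + m) ⇒ (n + b + m)
| eh_id_comp a b f : eh_typed a b f -> eh_id b ∘ f ≈ f :> a ⇒ b
| eh_comp_id a b f : eh_typed a b f -> f ∘ eh_id a ≈ f :> a ⇒ b
| eh_compA a b c d h g f :
    eh_typed c d h -> eh_typed b c g -> eh_typed a b f ->
    h ∘ (g ∘ f) ≈ (h ∘ g) ∘ f :> a ⇒ d
| eh_shift_id : eh_prim 1 Hone 0 ≈ eh_id 1 :> 1 ⇒ 1
| eh_interchange (xi th : eh_gen) r :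
    xi <> Hone -> th <> Hone ->
    eh_prim (eh_tgt xi + r) th 0 ∘ eh_prim 0 xi (r + eh_src th)
      ≈ eh_prim 0 xi (r + eh_tgt th) ∘ eh_prim (eh_src xi + r) th 0
      :> (eh_src xi + r + eh_src th) ⇒ (eh_tgt xi + r + eh_tgt th)
| eh_tau_tau : eh_prim 0 Htau 0 ∘ eh_prim 0 Htau 0 ≈ eh_id 2 :> 2 ⇒ 2
| eh_tau_braid :
    eh_prim 1 Htau 0 ∘ eh_prim 0 Htau 1 ∘ eh_prim 1 Htau 0
      ≈ eh_prim 0 Htau 1 ∘ eh_prim 1 Htau 0 ∘ eh_prim 0 Htau 1 :> 3 ⇒ 3
| eh_tau_u : eh_prim 0 Htau 0 ∘ eh_prim 0 Hu 1 ≈ eh_prim 1 Hu 0 :> 1 ⇒ 2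
| eh_eps_tau : eh_prim 0 Heps 1 ∘ eh_prim 0 Htau 0 ≈ eh_prim 1 Heps 0 :> 2 ⇒ 1
| eh_eps_u : eh_prim 0 Heps 0 ∘ eh_prim 0 Hu 0 ≈ eh_id 0 :> 0 ⇒ 0
| eh_H_H : eh_prim 0 Hbar 0 ∘ eh_prim 0 Hbar 0 ≈ eh_prim 0 Hbar 0 :> 2 ⇒ 2
| eh_tau_H_tau :
    eh_prim 1 Htau 0 ∘ eh_prim 0 Hbar 1 ∘ eh_prim 1 Htau 0
      ≈ eh_prim 0 Htau 1 ∘ eh_prim 1 Hbar 0 ∘ eh_prim 0 Htau 1 :> 3 ⇒ 3
| eh_tau_H : eh_prim 0 Htau 0 ∘ eh_prim 0 Hbar 0 ≈ eh_prim 0 Hbar 0 :> 2 ⇒ 2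
| eh_H_tau : eh_prim 0 Hbar 0 ≈ eh_prim 0 Hbar 0 ∘ eh_prim 0 Htau 0 :> 2 ⇒ 2
| eh_eps_H_u :
    eh_prim 0 Heps 1 ∘ eh_prim 0 Hbar 0 ∘ eh_prim 0 Hu 1 ≈ eh_id 1 :> 1 ⇒ 1
| eh_H_comm :
    eh_prim 1 Hbar 0 ∘ eh_prim 0 Hbar 1
      ≈ eh_prim 0 Hbar 1 ∘ eh_prim 1 Hbar 0 :> 3 ⇒ 3
where "f ≈ g :> a ⇒ b" := (eh_eq a b f%eh g%eh).

Lemma eh_shift_typed n m a b f :
  eh_typed a b f -> eh_typed (n + a + m) (n + b + m) (eh_shift n f m).
Proof.
move=> h; elim: h => {a b f} [k th l|a b c g f _ hg _ hf] /=; last first.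
  exact: typed_comp hg hf.
have E x : n + (k + x + l) + m = n + k + x + (l + m) by rewrite !addnA.
rewrite !E; exact: typed_prim.
Qed.

Lemma typed_primE n th m a b :
  a = n + eh_src th + m -> b = n + eh_tgt th + m ->
  eh_typed a b (eh_prim n th m).
Proof. by move=> -> ->; exact: typed_prim. Qed.

Lemma eh_eq_typed a b f g :
  f ≈ g :> a ⇒ b -> eh_typed a b f /\ eh_typed a b g.
Proof.
have id_typed c : eh_typed c c (eh_id c) by apply: typed_primE.
elim=> {a b f g}.
- by [].
- by move=> a b f g _ [].
- by move=> a b f g h _ [hf _] _ [_ hh].
- move=> a b c g g' f f' _ [hg hg'] _ [hf hf'].
  by split; [exact: typed_comp hg hf | exact: typed_comp hg' hf'].
- by move=> n m a b f g _ [hf hg]; split; exact: eh_shift_typed.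
- by move=> a b f hf; split=> //; exact: typed_comp (id_typed _) hf.
- by move=> a b f hf; split=> //; exact: typed_comp hf (id_typed _).
- move=> a b c d h g f hh hg hf; split.
    exact: typed_comp hh (typed_comp hg hf).
  exact: typed_comp (typed_comp hh hg) hf.
- by split; apply: typed_primE.
- move=> xi th r _ _; split.
    apply: (@typed_comp _ (eh_tgt xi + r + eh_src th));
    by apply: typed_primE; rewrite ?addn0 ?addnA.
  apply: (@typed_comp _ (eh_src xi + r + eh_tgt th));
  by apply: typed_primE; rewrite ?addn0 ?addnA.
all: split; repeat first
  [ by apply: typed_primE
  | eapply typed_comp; last by apply: typed_primE ].
Qed.

Definition eh_arrow_term (a b : nat) : Type := {f : eh_term | eh_typed a b f}.

Definition eh_teq (a b : nat) (f g : eh_arrow_term a b) : Prop :=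
  proj1_sig f ≈ proj1_sig g :> a ⇒ b.

Lemma eh_id_typed n : eh_typed n n (eh_id n).
Proof. by apply: typed_primE. Qed.

Definition eh_tid (n : nat) : eh_arrow_term n n :=
  exist _ (eh_id n) (eh_id_typed n).

Definition eh_tcmp (a b c : nat)
    (g : eh_arrow_term b c) (f : eh_arrow_term a b) : eh_arrow_term a c :=
  exist _ (eh_comp (proj1_sig g) (proj1_sig f))
    (typed_comp (proj2_sig g) (proj2_sig f)).

Definition EFH_presentation : presentation :=
  @Presentation nat eh_arrow_term eh_teq eh_tid eh_tcmp
    (fun a b f => eh_refl (proj2_sig f))
    (fun a b f g => @eh_sym a b _ _)
    (fun a b f g h => @eh_trans a b _ _ _)
    (fun a b c g g' f f' => @eh_comp_congr a b c _ _ _ _)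
    (fun a b f => eh_id_comp (proj2_sig f))
    (fun a b f => eh_comp_id (proj2_sig f))
    (fun a b c d h g f =>
      eh_compA (proj2_sig h) (proj2_sig g) (proj2_sig f)).

Definition EFH : category := presented EFH_presentation.

(* The disjoint union of the source [n] and the target [m] is ['I_n + 'I_m];
   a relation is a set of ordered pairs. *)
Definition is_equivalence (T : finType) (R : {set T * T}) : bool :=
  [&& [forall x, (x, x) \in R],
      [forall x, forall y, ((x, y) \in R) ==> ((y, x) \in R)]
    & [forall x, forall y, forall z,
        ((x, y) \in R) && ((y, z) \in R) ==> ((x, z) \in R)]].

Lemma is_equivalenceP (T : finType) (R : {set T * T}) :
  reflect [/\ forall x, (x, x) \in R,
              forall x y, (x, y) \in R -> (y, x) \in R
            & forall x y z, (x, y) \in R -> (y, z) \in R -> (x, z) \in R]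
          (is_equivalence R).
Proof.
apply: (iffP and3P) => -[r s t]; split.
- exact/forallP.
- by move=> x y; move/forallP/(_ x)/forallP/(_ y)/implyP: s; exact.
- move=> x y z xy yz; move: t => /forallP/(_ x)/forallP/(_ y)/forallP/(_ z).
  by rewrite xy yz.
- exact/forallP.
- by apply/forallP=> x; apply/forallP=> y; apply/implyP; exact: s.
- apply/forallP=> x; apply/forallP=> y; apply/forallP=> z.
  by apply/implyP=> /andP[]; exact: t.
Qed.

Definition split_equiv (n m : nat) : Type :=
  {R : {set ('I_n + 'I_m) * ('I_n + 'I_m)} | is_equivalence R}.

Definition gen_val (n : nat) (x : 'I_n + 'I_n) : 'I_n :=
  match x with inl a => a | inr a => a end.

Definition gen_id_set (n : nat) : {set ('I_n + 'I_n) * ('I_n + 'I_n)} :=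
  [set p | gen_val p.1 == gen_val p.2].

(* In ['I_n + 'I_m + 'I_k], read as [('I_n + 'I_m) + 'I_k], the middle summand
   is the common copy of [m] along which [P] and [Q] are glued. *)
Definition relabel_l (n m k : nat) (x : 'I_n + 'I_m) : 'I_n + 'I_m + 'I_k :=
  inl x.

Definition relabel_r (n m k : nat) (x : 'I_m + 'I_k) : 'I_n + 'I_m + 'I_k :=
  match x with inl b => inl (inr b) | inr c => inr c end.

Definition outer (n m k : nat) (x : 'I_n + 'I_k) : 'I_n + 'I_m + 'I_k :=
  match x with inl a => inl (inl a) | inr c => inr c end.

Definition glue (n m k : nat) (Q : {set ('I_m + 'I_k) * ('I_m + 'I_k)})
    (P : {set ('I_n + 'I_m) * ('I_n + 'I_m)}) :
    {set ('I_n + 'I_m + 'I_k) * ('I_n + 'I_m + 'I_k)} :=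
  [set (relabel_l k p.1, relabel_l k p.2) | p in P]
  :|: [set (relabel_r n q.1, relabel_r n q.2) | q in Q].

(* [connect] is the reflexive transitive closure; it agrees here with the
   transitive closure, [glue Q P] being reflexive when [P] and [Q] are. *)
Definition gen_cmp_set (n m k : nat) (Q : {set ('I_m + 'I_k) * ('I_m + 'I_k)})
    (P : {set ('I_n + 'I_m) * ('I_n + 'I_m)}) :
    {set ('I_n + 'I_k) * ('I_n + 'I_k)} :=
  [set p | connect [rel x y | (x, y) \in glue Q P]
             (outer m p.1) (outer m p.2)].

Lemma gen_id_equiv n : is_equivalence (gen_id_set n).
Proof.
apply/is_equivalenceP; split=> [x|x y|x y z]; rewrite !inE //=.
  by rewrite eq_sym.
by move=> /eqP ->.
Qed.

Lemma glue_sym n m k (Q : split_equiv m k) (P : split_equiv n m) x y :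
  (x, y) \in glue (val Q) (val P) -> (y, x) \in glue (val Q) (val P).
Proof.
have [[_ sQ _] [_ sP _]] := (is_equivalenceP _ (valP Q), is_equivalenceP _ (valP P)).
rewrite !inE => /orP[]/imsetP[[a b] /= ab [-> ->]]; apply/orP; [left|right].
  by apply/imsetP; exists (b, a) => //; exact: sP.
by apply/imsetP; exists (b, a) => //; exact: sQ.
Qed.

Lemma connect_glue_sym n m k (Q : split_equiv m k) (P : split_equiv n m) :
  connect_sym [rel x y | (x, y) \in glue (val Q) (val P)].
Proof.
by apply: sym_connect_sym => x y /=; apply/idP/idP; exact: glue_sym.
Qed.

Lemma gen_cmp_equiv n m k (Q : split_equiv m k) (P : split_equiv n m) :
  is_equivalence (gen_cmp_set (val Q) (val P)).
Proof.
apply/is_equivalenceP; split=> [x|x y|x y z]; rewrite !inE /=.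
- exact: connect0.
- by rewrite connect_glue_sym.
- exact: connect_trans.
Qed.

Definition gen_id (n : nat) : split_equiv n n :=
  exist _ (gen_id_set n) (gen_id_equiv n).

Definition gen_cmp (n m k : nat) (Q : split_equiv m k) (P : split_equiv n m) :
    split_equiv n k :=
  exist _ (gen_cmp_set (val Q) (val P)) (gen_cmp_equiv Q P).

(* A split equivalence is determined by the two-valued colourings of its
   source and target that are constant on its classes, and composition of split
   equivalences becomes composition of relations between colourings. *)
Definition colour (n m : nat) (c : pred 'I_n) (d : pred 'I_m)
    (x : 'I_n + 'I_m) : bool :=
  match x with inl a => c a | inr b => d b end.

Definition agree (n m : nat) (P : split_equiv n m)
    (c : pred 'I_n) (d : pred 'I_m) : Prop :=
  forall x y, (x, y) \in val P -> colour c d x = colour c d y.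

Lemma agree_inj n m (P Q : split_equiv n m) :
  (forall c d, agree P c d <-> agree Q c d) -> P = Q.
Proof.
have sub (R S : split_equiv n m) : (forall c d, agree S c d -> agree R c d) ->
    {subset val R <= val S}.
  move=> RS [x y] xyR.
  have [rS sS tS] := is_equivalenceP _ (valP S).
  pose f z := (x, z) \in val S.
  have fE z : colour (fun a => f (inl a)) (fun b => f (inr b)) z = f z.
    by case: z.
  have /(_ _ _ xyR) : agree R (fun a => f (inl a)) (fun b => f (inr b)).
    apply: RS => z t zt; rewrite !fE /f; apply/idP/idP => h.
      exact: tS h zt.
    exact: tS h (sS _ _ zt).
  by rewrite !fE /f rS => /esym.
move=> PQ; apply/val_inj/eqP; rewrite eqEsubset; apply/andP; split.
  by apply/subsetP/sub => c d /PQ.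
by apply/subsetP/sub => c d /PQ.
Qed.

Lemma agree_id n c d : agree (gen_id n) c d <-> c =1 d.
Proof.
split=> [h a|h x y].
  by apply: (h (inl a) (inr a)); rewrite inE.
by rewrite inE => /eqP; case: x y => x [] y /= ->; rewrite ?h.
Qed.

Lemma agree_cmp n m k (Q : split_equiv m k) (P : split_equiv n m) c e :
  agree (gen_cmp Q P) c e <-> exists d, agree P c d /\ agree Q d e.
Proof.
set r := [rel x y | (x, y) \in glue (val Q) (val P)].
have rl x y : (x, y) \in val P -> r (relabel_l k x) (relabel_l k y).
  by move=> xy; rewrite /= inE; apply/orP; left; apply/imsetP; exists (x, y).
have rr x y : (x, y) \in val Q -> r (relabel_r n x) (relabel_r n y).
  by move=> xy; rewrite /= inE; apply/orP; right; apply/imsetP; exists (x, y).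
split=> [h|[d [hP hQ]] x y]; last first.
  rewrite inE /= -/r => xy.
  pose f (z : 'I_n + 'I_m + 'I_k) :=
    match z with inl t => colour c d t | inr b => e b end.
  have fo z : f (outer m z) = colour c e z by case: z.
  have fr z : f (relabel_r n z) = colour d e z by case: z.
  rewrite -!fo; apply: (closed_connect (a := f) (e := r)) xy => s t /=.
  rewrite inE => /orP[]/imsetP[[a b] /= ab [-> ->]]; rewrite -!topredE /=.
    exact: hP.
  by rewrite !fr; exact: hQ.
pose f (z : 'I_n + 'I_m + 'I_k) :=
  [exists x, connect r (outer m x) z && colour c e x].
have fo z : f (outer m z) = colour c e z.
  apply/existsP/idP => [[x /andP[xz cx]]|cz]; last first.
    by exists z; rewrite connect0.
  by rewrite -(h x z) // inE.
have fr s t : r s t -> f s = f t.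
  have imp s' t' : r s' t' -> f s' -> f t'.
    move=> st /existsP[x /andP[xs cx]]; apply/existsP; exists x.
    by rewrite cx andbT (connect_trans xs (connect1 st)).
  by move=> st; apply/idP/idP; apply: imp => //; exact: glue_sym.
exists (fun b => f (inl (inr b))); split=> x y xy.
  have E z : colour c (fun b => f (inl (inr b))) z = f (relabel_l k z).
    by case: z => // a; exact/esym/(fo (inl a)).
  by rewrite !E; apply: fr; exact: rl.
have E z : colour (fun b => f (inl (inr b))) e z = f (relabel_r n z).
  by case: z => // a; exact/esym/(fo (inr a)).
by rewrite !E; apply: fr; exact: rr.
Qed.

Lemma gen_cmp1m n m (P : split_equiv n m) : gen_cmp (gen_id m) P = P.
Proof.
apply: agree_inj => c e; split=> [/agree_cmp[d [h /agree_id de]]|h].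
  by move=> x y /h; case: x y => x [] y /=; rewrite -?de.
by apply/agree_cmp; exists e; split=> //; exact/agree_id.
Qed.

Lemma gen_cmpm1 n m (P : split_equiv n m) : gen_cmp P (gen_id n) = P.
Proof.
apply: agree_inj => c e; split=> [/agree_cmp[d [/agree_id cd h]]|h].
  by move=> x y /h; case: x y => x [] y /=; rewrite ?cd.
by apply/agree_cmp; exists c; split=> //; exact/agree_id.
Qed.

Lemma gen_cmpA n m k l
    (R : split_equiv k l) (Q : split_equiv m k) (P : split_equiv n m) :
  gen_cmp R (gen_cmp Q P) = gen_cmp (gen_cmp R Q) P.
Proof.
apply: agree_inj => c f; split.
  move=> /agree_cmp[e [/agree_cmp[d [hP hQ]] hR]].
  apply/agree_cmp; exists d; split=> //.
  by apply/agree_cmp; exists e.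
move=> /agree_cmp[d [hP /agree_cmp[e [hQ hR]]]].
apply/agree_cmp; exists e; split=> //.
by apply/agree_cmp; exists d.
Qed.

Definition Gen : category :=
  @Category nat split_equiv gen_id gen_cmp gen_cmp1m gen_cmpm1 gen_cmpA.

(* Main.v *)
From mathcomp Require Import all_boot.
From mathcomp Require Import boolp.
Require Import Defs.

Set Implicit Arguments.
Unset Strict Implicit.
Unset Printing Implicit Defensive.

(** Both syntactic categories have the same underlying structure: an endofunctor
adding a strand on the left, natural arrows [tau], [bar], [uni], [cou] (where
[bar], the arrow written H-bar, links two adjacent strands; in EF it is
[Δ ∘ ∇], and conversely [∇] is [cou ∘ bar] and [Δ] is [bar ∘ uni]), and the
equations of EFH.  The record [strands] captures this, and [strands_iso] shows
that each instance is isomorphic to Gen, the isomorphism being the identity on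
objects; the two instances [EF_strands] and [EFH_strands] then give the theorem.

Soundness.  An arrow [n -> m] is read as a relation between two-colourings of
its source and of its target, the colour of a strand being constant along
connected pieces.  A split equivalence is determined by the colourings that it
allows, and composition in Gen is composition of these relations, so that every
arrow gets a split equivalence [gen_of f] compatibly with composition.

Completeness.  For strands [i] and [j] out of [n], an arrow [link i j n]
generalizes [bar] to strands that are not adjacent.  These arrows commute, are
idempotent, are permuted by the symmetries ([perm_link]), and satisfy
[link i j ∘ link j k = link i j ∘ link i k]; hence a product of links depends
only on the equivalence generated by its pairs, equivalently on the colourings
constant on these pairs ([links_eq]).  Every arrow [n -> m] has a normal form
([normal_form_all]): create [m] new strands, multiply by links between the
[m + n] strands, delete the [n] old ones.  Composing a normal form with a
generator gives a normal form; the interesting case is the counit, where the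
strand to be deleted is first separated from all the others but at most one
([links_isolate]), after which [cou_link0_uni] or [cou_uni] removes it.  The
identities have a normal form because normal forms are stable under adding a
strand ([normal_form_shift]).  The normal form of an arrow can be read off its
relation, whence [gen_of] is injective, and any list of pairs may occur in it,
whence [gen_of] is surjective. *)

(** * Relations between colourings *)

(** Colourings of [n] strands are completed to infinite streams, and a relation
    associated to an arrow from [n] to [m] identifies the part of the first
    stream beyond [n] with the part of the second one beyond [m].  The
    definitions below then do not mention the number of strands, and untyped
    terms can be interpreted too. *)
Definition stream := nat -> bool.
Definition tl (C : stream) : stream := fun k => C k.+1.
Definition scons (b : bool) (C : stream) : stream :=
  fun k => if k is k'.+1 then C k' else b.

Definition srel := stream -> stream -> Prop.
Definition graph (f : stream -> stream) : srel := fun C D => D = f C.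
Definition cograph (f : stream -> stream) : srel := fun C D => C = f D.
Definition rcmp (S R : srel) : srel := fun C D => exists B, R C B /\ S B D.
Definition rlift (R : srel) : srel := fun C D => C 0 = D 0 /\ R (tl C) (tl D).

Definition stau (C : stream) := scons (C 1) (scons (C 0) (tl (tl C))).
Definition rbar : srel := fun C D => C = D /\ C 0 = C 1.

Lemma scons_eta C : scons (C 0) (tl C) = C.
Proof. by apply/funext => -[]. Qed.

(** Read backwards ([cograph]), [sdup] is the merging [∇]; read forwards
    ([graph]), it is the splitting [Δ]. *)
Definition sdup (C : stream) : stream := scons (C 0) C.
Definition slift (f : stream -> stream) (C : stream) := scons (C 0) (f (tl C)).

Lemma srel_eq (R S : srel) : (forall C D, R C D <-> S C D) -> R = S.
Proof. by move=> e; apply/funext => C; apply/funext => D; apply/propext. Qed.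

Lemma rlift_graph f : rlift (graph f) = graph (slift f).
Proof.
apply: srel_eq => C D; split=> [[e0 e]|->//].
by rewrite /graph -(scons_eta D) -e0 e.
Qed.

Lemma rlift_cograph f : rlift (cograph f) = cograph (slift f).
Proof.
apply: srel_eq => C D; split=> [[e0 e]|->//].
by rewrite /cograph -(scons_eta C) e0 e.
Qed.

Lemma rcmp_graph g f : rcmp (graph g) (graph f) = graph (g \o f).
Proof.
by apply: srel_eq => C D; split=> [[B [-> ->]]//|->]; exists (f C).
Qed.

Lemma rcmp_cograph g f : rcmp (cograph g) (cograph f) = cograph (f \o g).
Proof.
by apply: srel_eq => C D; split=> [[B [-> ->]]//|->]; exists (g D).
Qed.

Lemma rcmp_graphr R f : rcmp R (graph f) = fun C D => R (f C) D.
Proof.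
by apply: srel_eq => C D; split=> [[B [-> ?]]//|?]; exists (f C).
Qed.

Lemma rcmp_cographl R f : rcmp (cograph f) R = fun C D => R C (f D).
Proof.
by apply: srel_eq => C D; split=> [[B [? <-]]//|?]; exists (f D).
Qed.

Lemma cograph_stau : cograph stau = graph stau.
Proof. by apply: srel_eq => C D; split=> ->; apply/funext => -[|[|k]]. Qed.

Lemma cograph_id : cograph id = graph id.
Proof. by apply: srel_eq => C D; split=> ->. Qed.

Lemma rlift1 : rlift (graph id) = graph id.
Proof. by rewrite rlift_graph; congr graph; apply/funext => C; exact: scons_eta. Qed.

Lemma rliftM R S : rlift (rcmp S R) = rcmp (rlift S) (rlift R).
Proof.
apply: srel_eq => C D; split=> [[e [B [RB SB]]]|[B [[CB RB] [BD SB]]]].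
  by exists (scons (C 0) B).
by split; [rewrite CB | exists (tl B)].
Qed.

Lemma rcmp1 R : rcmp (graph id) R = R.
Proof. by rewrite -cograph_id rcmp_cographl. Qed.

Lemma rcmpr1 R : rcmp R (graph id) = R.
Proof. by rewrite rcmp_graphr. Qed.

Lemma rcmpA T S R : rcmp T (rcmp S R) = rcmp (rcmp T S) R.
Proof.
apply: srel_eq => C D; split=> [[B [[A [RA SA]] TB]]|[B [RB [A [SA TA]]]]].
  by exists A; split=> //; exists B.
by exists A; split=> //; exists B.
Qed.

Lemma rbarE : rbar = rcmp (graph sdup) (cograph sdup).
Proof.
apply: srel_eq => C D; split=> [[<- e]|[B [-> ->]]//].
exists (tl C); rewrite /cograph /graph /sdup; split; rewrite -{1}(scons_eta C); by rewrite e.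
Qed.

Lemma rtau_nat R :
  rcmp (graph stau) (rlift (rlift R)) = rcmp (rlift (rlift R)) (graph stau).
Proof.
rewrite -{1}cograph_stau rcmp_graphr rcmp_cographl.
by apply: srel_eq => C D; split=> -[? [? ?]]; split=> //; split.
Qed.

Lemma rnab_nat R :
  rcmp (cograph sdup) (rlift (rlift R)) = rcmp (rlift R) (cograph sdup).
Proof.
rewrite rcmp_cographl; apply: srel_eq => C D; split=> [[C0 [C1 r]]|[B [-> [B0 r]]]]; last by [].
by exists (tl C); split; last by []; rewrite /cograph -[LHS]scons_eta /sdup C0 C1.
Qed.

Lemma rdel_nat R :
  rcmp (graph sdup) (rlift R) = rcmp (rlift (rlift R)) (graph sdup).
Proof.
rewrite rcmp_graphr; apply: srel_eq => C D; split=> [[B [[B0 r] ->]]//|[C0 [C1 r]]].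
by exists (tl D); split; first by []; rewrite /graph -[LHS]scons_eta /sdup -C0 -C1.
Qed.

Lemma rbar_nat R :
  rcmp rbar (rlift (rlift R)) = rcmp (rlift (rlift R)) rbar.
Proof. by rewrite rbarE -rcmpA rnab_nat !rcmpA rdel_nat. Qed.

Lemma runi_nat R : rcmp (cograph tl) R = rcmp (rlift R) (cograph tl).
Proof.
rewrite rcmp_cographl; apply: srel_eq => C D; split=> [r|[B [-> []]]//].
by exists (scons (D 0) C).
Qed.

Lemma rcou_nat R : rcmp (graph tl) (rlift R) = rcmp R (graph tl).
Proof.
rewrite rcmp_graphr; apply: srel_eq => C D; split=> [[B [[_ r] ->]]//|r].
by exists (scons (C 0) D).
Qed.

(** All the generators but [rbar] are graphs or converses of graphs of functions
    on streams, and [stau] is both.  An equation whose sides are composed of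
    graphs only, or of converses only, reduces to an equation between functions
    that differ from a shift on the first few entries only. *)
Ltac by_graphs :=
  rewrite ?rlift_graph ?rcmp_graph; congr graph;
  apply/funext => C; apply/funext => -[|[|[|k]]].

Ltac by_cographs :=
  rewrite -?cograph_stau -?cograph_id ?rlift_cograph ?rcmp_cograph; congr cograph;
  apply/funext => C; apply/funext => -[|[|[|k]]].

Lemma rtauK : rcmp (graph stau) (graph stau) = graph id.
Proof. by by_graphs. Qed.

Lemma rtau_braid :
  rcmp (rcmp (rlift (graph stau)) (graph stau)) (rlift (graph stau)) =
  rcmp (rcmp (graph stau) (rlift (graph stau))) (graph stau).
Proof. by by_graphs. Qed.

Lemma rtau_uni : rcmp (graph stau) (cograph tl) = rlift (cograph tl).
Proof. by by_cographs. Qed.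

Lemma rcou_tau : rcmp (graph tl) (graph stau) = rlift (graph tl).
Proof. by by_graphs. Qed.

Lemma rcou_uni : rcmp (graph tl) (cograph tl) = graph id.
Proof.
apply: srel_eq => C D; split=> [[B [-> ->]]//|->].
by exists (scons true C).
Qed.

Lemma rfrob_l :
  rcmp (rlift (cograph sdup)) (graph sdup) = rcmp (graph sdup) (cograph sdup).
Proof.
rewrite -rbarE rlift_cograph rcmp_graphr; apply: srel_eq => C D; split=> [e|[<- e]].
  have eC k : sdup C k = slift sdup D k by rewrite e.
  split; last by have := eC 1; have := eC 2; rewrite /slift /= => -> ->.
  by apply/funext => -[|k]; [exact: (eC 0) | exact: (eC k.+2)].
by apply/funext => -[|[|k]].
Qed.

Lemma rfrob_r :
  rcmp (cograph sdup) (rlift (graph sdup)) = rcmp (graph sdup) (cograph sdup).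
Proof.
rewrite -rbarE rlift_graph rcmp_cographl; apply: srel_eq => C D; split=> [e|[<- e]].
  have eC k : sdup D k = slift sdup C k by rewrite e.
  split; first by apply/funext => -[|k]; [exact/esym/(eC 0) | exact/esym/(eC k.+2)].
  by have := eC 1; have := eC 0; rewrite /slift /= => -> ->.
by apply/funext => -[|[|k]].
Qed.

Lemma rtau_nabM : rcmp (graph stau) (cograph sdup) =
  rcmp (rcmp (rlift (cograph sdup)) (graph stau)) (rlift (graph stau)).
Proof. by by_cographs. Qed.

Lemma rdelM_tau : rcmp (graph sdup) (graph stau) =
  rcmp (rcmp (rlift (graph stau)) (graph stau)) (rlift (graph sdup)).
Proof. by by_graphs. Qed.

Lemma rnab_del : rcmp (cograph sdup) (graph sdup) = graph id.
Proof.
rewrite rcmp_graphr; apply: srel_eq => C D; split=> [e|->//].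
by apply/funext => k; have {}e : sdup C = sdup D := e; have := congr1 (tl^~ k) e.
Qed.

Lemma rbar_bar : rcmp rbar rbar = rbar.
Proof. by rewrite rbarE -rcmpA (rcmpA (cograph sdup)) rnab_del rcmp1. Qed.

Lemma rtau_bar : rcmp (graph stau) rbar = rbar.
Proof.
rewrite -{1}cograph_stau rcmp_cographl; apply: srel_eq => C D; split=> [[-> e]|[<- e]].
  split; last exact/esym.
  by apply/funext => -[|[|k]] //=.
by split=> //; apply/funext => -[|[|k]].
Qed.

Lemma rbar_tau : rcmp rbar (graph stau) = rbar.
Proof.
rewrite rcmp_graphr; apply: srel_eq => C D; split=> [[<- e]|[<- e]].
  split; last exact/esym.
  by apply/funext => -[|[|k]] //=.
by split; [apply/funext => -[|[|k]] | exact/esym].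
Qed.

Lemma rlift_bar C D : rlift rbar C D <-> C = D /\ C 1 = C 2.
Proof.
split=> [[C0 [eC e]]|[<- e]//].
by split=> //; rewrite -(scons_eta C) -(scons_eta D) C0 eC.
Qed.

Lemma rtau_bar_tau :
  rcmp (rcmp (rlift (graph stau)) rbar) (rlift (graph stau))
  = rcmp (rcmp (graph stau) (rlift rbar)) (graph stau).
Proof.
rewrite rlift_graph !rcmp_graphr; apply: srel_eq => C D; split.
  move=> [B [[<- e] ->]]; exists (stau C); split; first exact/rlift_bar.
  by apply/funext => -[|[|[|k]]].
move=> [B [/rlift_bar[<- e] ->]]; exists (slift stau C); split; first by [].
by apply/funext => -[|[|[|k]]].
Qed.

Lemma rcou_bar_uni : rcmp (rcmp (graph tl) rbar) (cograph tl) = graph id.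
Proof.
apply: srel_eq => C D; split=> [[B [-> [B' [[<- _] ->]]]]//|->].
by exists (scons (C 0) C); split=> //; exists (scons (C 0) C).
Qed.

Lemma rbar_comm : rcmp (rlift rbar) rbar = rcmp rbar (rlift rbar).
Proof.
apply: srel_eq => C D; split.
  by move=> [B [[<- e] /rlift_bar[<- e']]]; exists C; split; [exact/rlift_bar |].
by move=> [B [/rlift_bar[<- e] [<- e']]]; exists C; split; [|exact/rlift_bar].
Qed.

(** * Strands *)

(** The equations of EFH in terms of the functor [shift], which adds a strand on
    the left.  Adding strands on the right is built into the families [tau],
    [bar], [uni], [cou] being indexed by all [n], and the interchange equations
    become naturality.  The field [strands_ind] says that the arrows are
    generated by the primitive ones; the existence of [sem] bounds the equations
    that may hold between arrows. *)
Record strands := Strands {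
  arr :> nat -> nat -> Type;
  one : forall n, arr n n;
  comp : forall n m k, arr m k -> arr n m -> arr n k;
  comp1f : forall n m (f : arr n m), comp (one m) f = f;
  compf1 : forall n m (f : arr n m), comp f (one n) = f;
  compA : forall n m k l (h : arr k l) (g : arr m k) (f : arr n m),
    comp h (comp g f) = comp (comp h g) f;
  shift : forall n m, arr n m -> arr n.+1 m.+1;
  shift1 : forall n, shift (one n) = one n.+1;
  shiftM : forall n m k (g : arr m k) (f : arr n m),
    shift (comp g f) = comp (shift g) (shift f);
  tau : forall n, arr n.+2 n.+2;
  bar : forall n, arr n.+2 n.+2;
  uni : forall n, arr n n.+1;
  cou : forall n, arr n.+1 n;
  tau_nat : forall n m (f : arr n m),
    comp (tau m) (shift (shift f)) = comp (shift (shift f)) (tau n);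
  bar_nat : forall n m (f : arr n m),
    comp (bar m) (shift (shift f)) = comp (shift (shift f)) (bar n);
  uni_nat : forall n m (f : arr n m), comp (uni m) f = comp (shift f) (uni n);
  cou_nat : forall n m (f : arr n m), comp (cou m) (shift f) = comp f (cou n);
  tauK : forall n, comp (tau n) (tau n) = one n.+2;
  tau_braid : forall n,
    comp (shift (tau n)) (comp (tau n.+1) (shift (tau n)))
    = comp (tau n.+1) (comp (shift (tau n)) (tau n.+1));
  tau_uni : forall n, comp (tau n) (uni n.+1) = shift (uni n);
  cou_tau : forall n, comp (cou n.+1) (tau n) = shift (cou n);
  cou_uni : forall n, comp (cou n) (uni n) = one n;
  bar_bar : forall n, comp (bar n) (bar n) = bar n;
  tau_bar_tau : forall n,
    comp (shift (tau n)) (comp (bar n.+1) (shift (tau n)))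
    = comp (tau n.+1) (comp (shift (bar n)) (tau n.+1));
  tau_bar : forall n, comp (tau n) (bar n) = bar n;
  bar_tau : forall n, comp (bar n) (tau n) = bar n;
  cou_bar_uni : forall n, comp (cou n.+1) (comp (bar n) (uni n.+1)) = one n.+1;
  bar_comm : forall n,
    comp (shift (bar n)) (bar n.+1) = comp (bar n.+1) (shift (bar n));
  strands_ind : forall P : forall n m, arr n m -> Prop,
    (forall n, P n n (one n)) ->
    (forall n m k (g : arr m k) (f : arr n m),
       P m k g -> P n m f -> P n k (comp g f)) ->
    (forall n m (f : arr n m), P n m f -> P n.+1 m.+1 (shift f)) ->
    (forall n, P n.+2 n.+2 (tau n)) -> (forall n, P n.+2 n.+2 (bar n)) ->
    (forall n, P n n.+1 (uni n)) -> (forall n, P n.+1 n (cou n)) ->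
    forall n m (f : arr n m), P n m f;
  sem : forall n m, arr n m -> srel;
  sem1 : forall n, sem (one n) = graph id;
  semM : forall n m k (g : arr m k) (f : arr n m),
    sem (comp g f) = rcmp (sem g) (sem f);
  sem_shift : forall n m (f : arr n m), sem (shift f) = rlift (sem f);
  sem_tau : forall n, sem (tau n) = graph stau;
  sem_bar : forall n, sem (bar n) = rbar;
  sem_uni : forall n, sem (uni n) = cograph tl;
  sem_cou : forall n, sem (cou n) = graph tl
}.
Arguments one {s} n.
Arguments tau {s} n.
Arguments bar {s} n.
Arguments uni {s} n.
Arguments cou {s} n.

Declare Scope strands_scope.
Delimit Scope strands_scope with st.
Local Open Scope strands_scope.
Notation "g ∘ f" := (comp g f) : strands_scope.

Section Theory.
Variable K : strands.

(** Compositions are kept associated to the right; this turns an equation into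
    one that applies in front of a further arrow. *)
Lemma whisk n m k (g : K m k) (f : K n m) (h : K n k) :
  g ∘ f = h -> forall l (x : K l n), g ∘ (f ∘ x) = h ∘ x.
Proof. by move=> <- l x; rewrite compA. Qed.

(** The strands are numbered from the left.  Outside of the range where it
    makes sense, [swap i n], as [link i j n] below, is an identity. *)
Fixpoint swap (i n : nat) : K n n :=
  match i, n return K n n with
  | 0, n'.+2 => tau n'
  | i'.+1, n'.+1 => shift (swap i' n')
  | _, n' => one n'
  end.

(** Links strand [0] with strand [j.+1] out of [n.+1]. *)
Fixpoint link0 (j n : nat) : K n.+1 n.+1 :=
  match j, n return K n.+1 n.+1 with
  | 0, n'.+1 => bar n'
  | j'.+1, n'.+1 => tau n' ∘ (shift (link0 j' n') ∘ tau n')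
  | _, 0 => one 1
  end.

(** In particular [link i i n] is the identity, which is the convention under
    which the laws of links hold without restriction. *)
Fixpoint link (i j n : nat) : K n n :=
  match i, j, n return K n n with
  | 0, j'.+1, n'.+1 => link0 j' n'
  | i'.+1, 0, n'.+1 => link0 i' n'
  | i'.+1, j'.+1, n'.+1 => shift (link i' j' n')
  | _, _, n' => one n'
  end.

(** The transposition of [k] and [k.+1]. *)
Fixpoint adj (k i : nat) : nat :=
  match k, i with
  | 0, 0 => 1
  | 0, 1 => 0
  | 0, _ => i
  | k'.+1, 0 => 0
  | k'.+1, i'.+1 => (adj k' i').+1
  end.

Lemma adjK k i : adj k (adj k i) = i.
Proof. by elim: k i => [|k IH] [|[|i]] //=; rewrite -1?[in RHS](IH i.+1) ?IH. Qed.

Lemma ltn_adj k i n : k.+1 < n -> i < n -> adj k i < n.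
Proof. by elim: k i n => [|k IH] [|[|i]] [|n] //= kn lt; apply: IH. Qed.

Lemma swapK k n : swap k n ∘ swap k n = one n.
Proof.
elim: k n => [|k IH] [|n] /=; rewrite ?compf1 //.
  by case: n => [|n]; rewrite ?compf1 ?tauK.
by rewrite -shiftM IH shift1.
Qed.

Lemma link_sym i j n : link i j n = link j i n.
Proof. by elim: i j n => [|i IH] [|j] [|n] //=; rewrite IH. Qed.

Lemma link_refl i n : link i i n = one n.
Proof. by elim: i n => [|i IH] [|n] //=; rewrite IH shift1. Qed.

Lemma link0_idem j n : link0 j n ∘ link0 j n = link0 j n.
Proof.
elim: j n => [|j IH] [|n] /=; rewrite ?compf1 ?bar_bar //.
by rewrite -!compA (whisk (tauK _ _)) comp1f (whisk (esym (shiftM _ _))) IH.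
Qed.

Lemma link_idem i j n : link i j n ∘ link i j n = link i j n.
Proof.
elim: i j n => [|i IH] [|j] [|n] /=; rewrite ?compf1 ?link0_idem //.
by rewrite -shiftM IH.
Qed.

(** Sliding [swap k.+1] along a link from strand [0].  The two cases where the
    link ends at one of the swapped strands are the equation [tau_bar_tau]; when
    it ends beyond them, the braid relation moves the swap across the two
    outer symmetries of the link. *)
Lemma shift_swap_link0 k j n : k.+1 < n -> j < n ->
  shift (swap k n) ∘ link0 j n = link0 (adj k j) n ∘ shift (swap k n).
Proof.
have inv n' : shift (tau n') ∘ shift (tau n') = one (n'.+3) :> K _ _.
  by rewrite -shiftM tauK shift1.
elim: k j n => [|k IH] j [//|[//|n]]; last first.
  case: j => [|j] kn jn /=; first by rewrite bar_nat.
  rewrite (whisk (esym (tau_nat _))) -!compA; congr (_ ∘ _).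
  by rewrite tau_nat !(whisk (esym (shiftM _ _))) IH // shiftM -compA.
move=> _; case: j => [|[|j]] /= jn.
- by rewrite -tau_bar_tau -!compA inv compf1.
- by rewrite -tau_bar_tau (whisk (inv _)) comp1f.
case: n jn => [|n] //= jn; rewrite !shiftM -!compA.
have braid l (x : K l n.+4) : shift (tau n.+1) ∘ (tau n.+2 ∘ (shift (tau n.+1) ∘ x))
    = tau n.+2 ∘ (shift (tau n.+1) ∘ (tau n.+2 ∘ x)).
  by have := whisk (tau_braid K n.+1) x; rewrite -!compA.
by rewrite tau_braid braid (whisk (tau_nat _)) -!compA.
Qed.

Lemma swap_link k i j n : k.+1 < n -> i < n -> j < n ->
  swap k n ∘ link i j n = link (adj k i) (adj k j) n ∘ swap k n.
Proof.
elim: k i j n => [|k IH] i j [//|n]; last first.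
  case: i j => [|i] [|j] //= kn lt_i lt_j; rewrite ?compf1 ?comp1f //.
  - exact: shift_swap_link0.
  - exact: shift_swap_link0.
  - by rewrite -shiftM IH // shiftM.
case: n => [//|n] _; wlog le_ij : i j / i <= j => [wl|] lt_i lt_j.
  case: (leqP i j) => [|/ltnW] ij; first exact: wl.
  by rewrite link_sym wl // link_sym.
case: i j le_ij lt_i lt_j => [|[|i]] [|[|j]] //= _ _ _;
  rewrite ?link_refl ?shift1 ?compf1 ?comp1f //.
- by rewrite tau_bar bar_tau.
- by case: n => [|n] //=; rewrite compA tauK comp1f.
- by case: n => [|n] //=; rewrite -!compA tauK compf1.
- exact: tau_nat.
Qed.

(** Composites of symmetries, with the permutation of the strands that they
    perform. *)
Inductive perm n : K n n -> (nat -> nat) -> Prop :=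
| perm_one : perm (one n) id
| perm_swap k w s : k.+1 < n -> perm w s -> perm (swap k n ∘ w) (adj k \o s).

Lemma perm_comp n (w v : K n n) s t :
  perm w s -> perm v t -> perm (w ∘ v) (s \o t).
Proof.
move=> pw pv; elim: pw => [|k w' s' kn _ IH]; first by rewrite comp1f.
by rewrite -compA; exact: perm_swap IH.
Qed.

Lemma perm_of_swap k n : k.+1 < n -> perm (swap k n) (adj k).
Proof. by move=> kn; rewrite -(compf1 (swap k n)); exact: (perm_swap kn (perm_one n)). Qed.

Lemma perm_inv n (w : K n n) s : perm w s -> exists v t,
  [/\ perm v t, v ∘ w = one n & w ∘ v = one n].
Proof.
elim=> [|k w' s' kn _ [v [t [pv vw wv]]]].
  by exists (one n), id; split; rewrite ?compf1 //; exact: perm_one.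
exists (v ∘ swap k n), (t \o adj k); split.
- exact: perm_comp pv (perm_of_swap kn).
- by rewrite -compA (whisk (swapK _ _)) comp1f.
- by rewrite -compA (whisk wv) comp1f swapK.
Qed.

Lemma perm_cancel n (w : K n n) s m (x y : K m n) :
  perm w s -> w ∘ x = w ∘ y -> x = y.
Proof.
by move=> /perm_inv[v [t [_ vw _]]] e; rewrite -(comp1f x) -vw -compA e compA vw comp1f.
Qed.

Lemma perm_shift n (w : K n n) s : perm w s -> exists t, perm (shift w) t.
Proof.
elim=> [|k w' s' kn _ [t pt]]; first by exists id; rewrite shift1; exact: perm_one.
by exists (adj k.+1 \o t); rewrite shiftM; exact: (@perm_swap n.+1 k.+1).
Qed.

Lemma perm_ltn n (w : K n n) s i : perm w s -> i < n -> s i < n.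
Proof. by move=> pw lt_i; elim: pw => //= k w' s' kn _; exact: ltn_adj. Qed.

Lemma perm_inj n (w : K n n) s : perm w s -> injective s.
Proof.
by elim=> [//|k w' s' kn _ inj]; apply: inj_comp inj; exact: can_inj (adjK k).
Qed.

Lemma perm_link n (w : K n n) s i j : perm w s -> i < n -> j < n ->
  w ∘ link i j n = link (s i) (s j) n ∘ w.
Proof.
move=> pw lt_i lt_j; elim: pw => [|k w' s' kn pw' IH]; first by rewrite comp1f compf1.
by rewrite -compA IH compA swap_link ?(perm_ltn pw') // -compA.
Qed.

Lemma adj_lt k i : i < k -> adj k i = i.
Proof. by elim: k i => [|k IH] [|i] //= /IH ->. Qed.

Lemma adj_S k : adj k k.+1 = k.
Proof. by elim: k => //= k ->. Qed.

Lemma perm_bubble n k x : k <= x -> x < n ->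
  exists w s, [/\ @perm n w s, s x = k & forall i, i < k -> s i = i].
Proof.
elim: x => [|x IH] kx xn.
  by exists (one n), id; split=> //; [exact: perm_one | case: k kx].
move: kx; rewrite leq_eqVlt => /orP[/eqP->|kx].
  by exists (one n), id; split=> //; exact: perm_one.
have [w [s [pw sx si]]] := IH kx (ltnW xn).
exists (w ∘ swap x n), (s \o adj x); split=> /=.
- exact: perm_comp pw (perm_of_swap xn).
- by rewrite adj_S.
- by move=> i ik; rewrite adj_lt ?si //; exact: leq_trans ik _.
Qed.

(** Any distinct strands can be brought to the leftmost positions, in order:
    the positions already filled are kept while the next strand is moved down
    to its place.  So a law about links involving several strands has to be
    proved for the first few strands only. *)
Lemma perm_straighten n (l : seq nat) : uniq l -> all (gtn n) l ->
  exists w s, @perm n w s /\ map s l = iota 0 (size l).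
Proof.
elim/last_ind: l => [|l x IH] /=; first by exists (one n), id; split=> //; exact: perm_one.
rewrite rcons_uniq all_rcons => /andP[xl ul] /andP[/= xn al].
have [w [s [pw sl]]] := IH ul al.
have sx : size l <= s x.
  rewrite leqNgt; apply/negP => lt.
  have : s x \in map s l by rewrite sl mem_iota.
  by rewrite (mem_map (perm_inj pw)) (negbTE xl).
have [v [t [pv tx ti]]] := perm_bubble sx (perm_ltn pw xn).
exists (v ∘ w), (t \o s); split; first exact: perm_comp.
rewrite map_rcons size_rcons -addn1 iotaD cats1 /= tx; congr rcons.
rewrite map_comp sl -[RHS]map_id; apply/eq_in_map => i.
by rewrite mem_iota => /andP[_]; exact: ti.
Qed.

(** Symmetries are invertible, so an equation between links can be checked after
    permuting the strands. *)
Lemma link_transfer n i j k l i' j' k' l' (w : K n n) s : perm w s ->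
  all (gtn n) [:: i; j; k; l; i'; j'; k'; l'] ->
  link (s i) (s j) n ∘ link (s k) (s l) n = link (s i') (s j') n ∘ link (s k') (s l') n ->
  link i j n ∘ link k l n = link i' j' n ∘ link k' l' n.
Proof.
move=> pw /=; do 8 (case/andP=> ?); move=> _ e; apply: (perm_cancel pw).
rewrite !compA !(perm_link pw) //.
by rewrite -!compA !(perm_link pw) // !compA e.
Qed.

(** On the strands 0, 1, 2, the link of 0 and 2 is a conjugate of that of 1 and
    2 by [tau], which [bar] absorbs. *)
Lemma link_triangle n i j k : i < n -> j < n -> k < n ->
  link i j n ∘ link j k n = link i j n ∘ link i k n.
Proof.
move=> lt_i lt_j lt_k.
have [->//|ij] := eqVneq i j.
have [->|jk] := eqVneq j k.
  by rewrite link_refl compf1 link_idem.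
have [->|ik] := eqVneq i k.
  by rewrite (link_sym j) link_refl compf1 link_idem.
have u : uniq [:: i; j; k] by rewrite /= !inE negb_or ij ik jk.
have [w [s [pw [si sj sk]]]] := @perm_straighten n _ u (ltac:(by rewrite /= lt_i lt_j lt_k)).
apply: (link_transfer pw); first by rewrite /= lt_i lt_j lt_k.
have : s k < n by exact: perm_ltn pw lt_k.
rewrite si sj sk; case: n {lt_i lt_j lt_k w pw} => [|[|[|n]]] //= _.
by rewrite (whisk (bar_tau _ _)) compA -bar_comm -compA bar_tau.
Qed.

Lemma link_commS n i j k : i < n -> j < n -> k < n ->
  link i j n ∘ link j k n = link j k n ∘ link i j n.
Proof.
move=> lt_i lt_j lt_k.
have [->|ij] := eqVneq i j; first by rewrite link_refl comp1f compf1.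
have [->|jk] := eqVneq j k; first by rewrite link_refl comp1f compf1.
have [->|ik] := eqVneq i k; first by rewrite (link_sym j).
have u : uniq [:: i; j; k] by rewrite /= !inE negb_or ij ik jk.
have [w [s [pw [si sj sk]]]] := @perm_straighten n _ u (ltac:(by rewrite /= lt_i lt_j lt_k)).
apply: (link_transfer pw); first by rewrite /= lt_i lt_j lt_k.
have : s k < n by exact: perm_ltn pw lt_k.
rewrite si sj sk; case: n {lt_i lt_j lt_k w pw} => [|[|[|n]]] //= _.
by rewrite -bar_comm.
Qed.

Lemma link_comm n i j k l : i < n -> j < n -> k < n -> l < n ->
  link i j n ∘ link k l n = link k l n ∘ link i j n.
Proof.
move=> lt_i lt_j lt_k lt_l.
have [->|ij] := eqVneq i j; first by rewrite link_refl comp1f compf1.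
have [->|kl] := eqVneq k l; first by rewrite link_refl comp1f compf1.
have [<-|jk] := eqVneq j k; first exact: link_commS.
have [<-|jl] := eqVneq j l; first by rewrite (link_sym k); exact: link_commS.
have [<-|ik] := eqVneq i k; first by rewrite (link_sym i j); exact: link_commS.
have [<-|il] := eqVneq i l; first by rewrite (link_sym k) (link_sym i j); exact: link_commS.
have u : uniq [:: i; j; k; l] by rewrite /= !inE !negb_or ij ik il jk jl kl.
have [w [s [pw [si sj sk sl]]]] :=
  @perm_straighten n _ u (ltac:(by rewrite /= lt_i lt_j lt_k lt_l)).
apply: (link_transfer pw); first by rewrite /= lt_i lt_j lt_k lt_l.
have : s l < n by exact: perm_ltn pw lt_l.
rewrite si sj sk sl; case: n {lt_i lt_j lt_k lt_l w pw} => [|[|[|[|n]]]] //= _.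
exact: bar_nat.
Qed.

(** The symmetries around a link to a distant strand turn the outer [uni] and
    [cou] into shifted ones, which reduces the distance by one. *)
Lemma cou_link0_uni j n : j < n ->
  cou n ∘ (link0 j n ∘ uni n) = one n.
Proof.
elim: j n => [|j IH] [|n] //= jn; first exact: cou_bar_uni.
rewrite -!compA tau_uni compA cou_tau -shiftM -shiftM compA.
by rewrite -compA IH // shift1.
Qed.

Definition bounded n (L : seq (nat * nat)) := all (fun p => (p.1 < n) && (p.2 < n)) L.

Definition links n (L : seq (nat * nat)) : K n n :=
  foldr (fun p f => link p.1 p.2 n ∘ f) (one n) L.

Lemma links_comm_link n L i j : i < n -> j < n -> bounded n L ->
  link i j n ∘ links n L = links n L ∘ link i j n.
Proof.
move=> lt_i lt_j; elim: L => [|[a b] L IH] /=; first by rewrite comp1f compf1.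
move=> /andP[/andP[lt_a lt_b] wL].
by rewrite (whisk (link_comm _ _ _ _)) // -!compA IH.
Qed.

Lemma links_comm n L L' : bounded n L -> bounded n L' ->
  links n L ∘ links n L' = links n L' ∘ links n L.
Proof.
move=> wL; elim: L' => [|[a b] L' IH] /=; first by rewrite comp1f compf1.
move=> /andP[/andP[lt_a lt_b] wL'].
by rewrite compA -links_comm_link // -!compA IH.
Qed.

Lemma link_absorb n L p : bounded n L -> p \in L ->
  link p.1 p.2 n ∘ links n L = links n L.
Proof.
elim: L => [|q L IH] //= /andP[/andP[q1 q2] wL].
rewrite inE => /orP[/eqP->|pL]; first by rewrite compA link_idem.
have /andP[p1 p2] := allP wL _ pL.
by rewrite compA link_comm // -compA IH.
Qed.

(** The colouring to use is the one that gives the strand [k] the truth value of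
    the statement that [links n L] absorbs the link of [i] and [k].  By
    [link_triangle] it is constant on the pairs of [L], and it holds at [i]
    itself, so that it holds at [j]. *)
Lemma links_forced n L i j : bounded n L -> i < n -> j < n ->
  (forall C : stream, {in L, forall p, C p.1 = C p.2} -> C i = C j) ->
  link i j n ∘ links n L = links n L.
Proof.
move=> wL lt_i lt_j forced.
pose C k : bool := `[< link i k n ∘ links n L = links n L >].
suff : C i = C j.
  by rewrite /C link_refl comp1f asboolT // => /esym/asboolP.
apply: forced => -[a b] pL /=; have /andP[/= lt_a lt_b] := allP wL _ pL.
apply/asbool_equiv_eq.
have ab := link_absorb wL pL; have ba := ab; rewrite /= link_sym in ba.
have imp x y : x < n -> y < n -> link x y n ∘ links n L = links n L ->
    link i x n ∘ links n L = links n L -> link i y n ∘ links n L = links n L.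
  move=> lt_x lt_y xy ix; rewrite -[in LHS]ix compA link_comm // -link_triangle //.
  by rewrite -compA xy.
by split; exact: imp.
Qed.

(** Each product absorbs the other one, and they commute. *)
Lemma links_eq n L L' : bounded n L -> bounded n L' ->
  (forall C : stream, {in L, forall p, C p.1 = C p.2} <->
                      {in L', forall p, C p.1 = C p.2}) ->
  links n L = links n L'.
Proof.
have absorb L1 L2 : bounded n L1 -> bounded n L2 ->
   (forall C : stream, {in L2, forall p, C p.1 = C p.2} ->
                       {in L1, forall p, C p.1 = C p.2}) ->
   links n L1 ∘ links n L2 = links n L2.
  move=> w1 w2; elim: L1 w1 => [|[a b] L1 IH] /=; first by rewrite comp1f.
  move=> /andP[/andP[lt_a lt_b] w1] imp.
  rewrite -compA IH //; last first.
    by move=> C /imp h p pL; apply: h; rewrite inE pL orbT.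
  apply: links_forced => // C /imp h; exact: (h (a, b) (mem_head _ _)).
move=> wL wL' e; rewrite -(absorb L' L) //; last by move=> C /e.
by rewrite links_comm // absorb // => C /e.
Qed.

Definition relabel (s : nat -> nat) := map (fun p : nat * nat => (s p.1, s p.2)).

Lemma bounded_relabel n m s L :
  (forall i, i < n -> s i < m) -> bounded n L -> bounded m (relabel s L).
Proof.
move=> sm; elim: L => [|p L IH] //= /andP[/andP[p1 p2] wL].
by rewrite !sm // IH.
Qed.

Lemma links_shift n L : links n.+1 (relabel S L) = shift (links n L).
Proof. by elim: L => [|p L IH] /=; rewrite ?shift1 // IH shiftM. Qed.

Lemma perm_links n (w : K n n) s L : perm w s -> bounded n L ->
  w ∘ links n L = links n (relabel s L) ∘ w.
Proof.
move=> pw; elim: L => [|p L IH] /=; first by rewrite compf1 comp1f.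
by move=> /andP[/andP[p1 p2] wL]; rewrite compA (perm_link pw) // -!compA IH.
Qed.

(** [cous m n] deletes the [n] last ones of [m + n] strands, and [unis m n] adds
    [m] strands before the [n] given ones.  The strands of the target come first
    so that composing with [uni m] or [cou m] changes [m + n] into [m.+1 + n] or
    back by computation, with no transport between types. *)
Fixpoint cous0 (n : nat) : K n 0 :=
  if n is n'.+1 then cous0 n' ∘ cou n' else one 0.
Fixpoint cous (m n : nat) : K (m + n) m :=
  if m is m'.+1 then shift (cous m' n) else cous0 n.
Fixpoint unis (m n : nat) : K n (m + n) :=
  if m is m'.+1 then uni (m' + n) ∘ unis m' n else one n.

Definition normal_form (n m : nat) L : K n m :=
  cous m n ∘ (links (m + n) L ∘ unis m n).

Definition has_normal_form n m (f : K n m) := exists2 L, bounded (m + n) L & f = normal_form n m L.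

Lemma swap_cous i m n : i.+1 < m ->
  swap i m ∘ cous m n = cous m n ∘ swap i (m + n).
Proof.
elim: i m => [|i IH] [|m] //=; last first.
  by rewrite ltnS => im; rewrite -!shiftM IH.
by case: m => [|m] //= _; rewrite tau_nat.
Qed.

Lemma bar_cous i m n : i.+1 < m ->
  link i i.+1 m ∘ cous m n = cous m n ∘ link i i.+1 (m + n).
Proof.
elim: i m => [|i IH] [|m] //=; last first.
  by rewrite ltnS => im; rewrite -!shiftM IH.
by case: m => [|m] //= _; rewrite bar_nat.
Qed.

Lemma swap_unis i m n : i.+1 < m -> swap i (m + n) ∘ unis m n = unis m n.
Proof.
elim: i m => [|i IH] [|m] //= im.
  by case: m im => [|m] //= _; rewrite (whisk (tau_uni _ _)) (whisk (esym (uni_nat _))) -!compA.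
by rewrite (whisk (esym (uni_nat _))) -!compA IH.
Qed.

Lemma normal_form_swap i n m (f : K n m) : i.+1 < m ->
  has_normal_form f -> has_normal_form (swap i m ∘ f).
Proof.
move=> im [L wL ->]; have imn : i.+1 < m + n by rewrite ltn_addr.
exists (relabel (adj i) L); first by apply: bounded_relabel wL => k; exact: ltn_adj.
rewrite /normal_form (whisk (swap_cous _ _)) // -!compA (whisk (perm_links (perm_of_swap imn) wL)).
by rewrite -compA swap_unis.
Qed.

Lemma normal_form_bar i n m (f : K n m) : i.+1 < m ->
  has_normal_form f -> has_normal_form (link i i.+1 m ∘ f).
Proof.
move=> im [L wL ->]; exists ((i, i.+1) :: L).
  by rewrite /= wL !ltn_addr // ltnW.
by rewrite /normal_form (whisk (bar_cous _ _)) // -!compA.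
Qed.

Lemma normal_form_uni n m (f : K n m) : has_normal_form f -> has_normal_form (uni m ∘ f).
Proof.
move=> [L wL ->]; exists (relabel S L); first exact: bounded_relabel wL.
by rewrite /normal_form (whisk (uni_nat _)) -compA (whisk (uni_nat _)) /= links_shift -!compA.
Qed.

(** By [link_triangle], once strand [0] is linked to [j], any other link from [0]
    can be replaced by a link from [j]. *)
Lemma links_isolate n L : bounded n.+1 L -> exists2 L', bounded n L' &
  links n.+1 L = shift (links n L') \/
  exists2 j, j < n & links n.+1 L = link0 j n ∘ shift (links n L').
Proof.
elim: L => [|[a b] L IH] /=.
  by exists [::] => //; left; rewrite shift1.
move=> /andP[/andP[lt_a lt_b] /IH[L' wL' eL]] {IH}.
have {lt_a lt_b} : a = b \/ exists c d, [/\ c < d, d < n.+1 & link a b n.+1 = link c d n.+1].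
  have [ab|ba|->] := ltngtP a b; [right|right|by left].
    by exists a, b.
  by exists b, a; rewrite link_sym.
case=> [->|[[|c] [[|d] [//= cd dn ->]]]].
- by exists L'; rewrite ?link_refl // comp1f.
- case: eL => [->|[j jn ->]]; first by exists L' => //; right; exists d.
  have dn' : d < n := dn; exists ((d, j) :: L'); first by rewrite /= wL' dn' jn.
  right; exists d => //=; rewrite shiftM !(compA (link0 d n)).
  by have := @link_triangle n.+1 0 d.+1 j.+1 isT dn jn; rewrite /= => ->; rewrite -compA.
- have dn' : d < n := dn; have cn : c < n := @ltn_trans d c n cd dn'.
  exists ((c, d) :: L'); first by rewrite /= wL' dn' cn.
  case: eL => [->|[j jn ->]]; [left|right]; first by rewrite /= shiftM.
  exists j => //=; rewrite shiftM !compA; congr (_ ∘ _).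
  exact: (@link_comm n.+1 c.+1 d.+1 0 j.+1 cn dn isT jn).
Qed.

Lemma normal_form_cou n m (f : K n m.+1) : has_normal_form f -> has_normal_form (cou m ∘ f).
Proof.
move=> [L wL ->]; have [L' wL' eL] := links_isolate wL.
exists L' => //; rewrite /normal_form /= (whisk (cou_nat _)) -compA; congr (_ ∘ _).
case: eL => [->|[j jn ->]].
  by rewrite (whisk (cou_nat _)) -!compA (whisk (cou_uni _ _)) comp1f.
rewrite -!compA (whisk (esym (uni_nat _))) -!compA.
by rewrite (compA (link0 _ _)) (whisk (cou_link0_uni jn)) comp1f.
Qed.

(** Adding a strand to a normal form turns [m + n] into [m.+1 + n.+1]; the new
    strand count is reached through [addnS], which holds up to a proof only. *)
Definition cast n n' (e : n = n') : K n n' := eq_rect n (K n) (one n) n' e.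

Lemma shift_cast n n' (e : n = n') : shift (cast e) = cast (congr1 S e).
Proof. by case: _ / e; rewrite /= shift1. Qed.

Lemma cast_links n n' (e : n = n') L : links n' L ∘ cast e = cast e ∘ links n L.
Proof. by case: _ / e; rewrite compf1 comp1f. Qed.

(** Moves strand [m] to the leftmost position. *)
Fixpoint cycle (m n : nat) : K (m + n).+1 (m + n).+1 :=
  if m is m'.+1 then tau (m' + n) ∘ shift (cycle m' n) else one n.+1.

Lemma perm_cycle m n : exists s, perm (cycle m n) s.
Proof.
elim: m => [|m [s ps]] /=; first by exists id; exact: perm_one.
by have [t pt] := perm_shift ps; exists (adj 0 \o t); exact: (@perm_swap _ 0).
Qed.

Lemma cousS m n :
  cous m n.+1 = cous m n ∘ (cou (m + n) ∘ (cycle m n ∘ cast (addnS m n))).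
Proof.
elim: m => [|m IH] /=.
  by rewrite (eq_irrelevance (addnS 0 n) erefl) /= !compf1.
rewrite IH !shiftM -!compA (whisk (cou_tau _ _)) shift_cast.
by rewrite (eq_irrelevance (addnS m.+1 n) (congr1 S (addnS m n))).
Qed.

Lemma shift_unis m n :
  shift (unis m n) = cycle m n ∘ (cast (addnS m n) ∘ unis m n.+1).
Proof.
elim: m => [|m IH] /=.
  by rewrite (eq_irrelevance (addnS 0 n) erefl) /= !compf1 shift1.
rewrite !shiftM IH -tau_uni -!compA; congr (_ ∘ _).
rewrite (eq_irrelevance (addnS m.+1 n) (congr1 S (addnS m n))) -shift_cast.
by rewrite (whisk (uni_nat _)) -!compA (whisk (uni_nat _)) -!compA.
Qed.

(** The new strand, at position [0], would be both an old and a new one.  It is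
    split in two by creating a strand, linking both and deleting one of them
    ([cou_bar_uni]); the symmetry absorbed by the link exchanges them, and
    [cycle] carries the deleted one to its place among the old strands. *)
Lemma normal_form_shift n m (f : K n m) : has_normal_form f -> has_normal_form (shift f).
Proof.
move=> [L wL ->].
have [s ps] := perm_cycle m n; have [t pt] := perm_shift ps.
have [v [r [pv vw wv]]] := perm_inv pt.
(* [L2] links the two halves of the new strand, at positions 0 and 1; the links
   of [L] are moved up by two positions. *)
have [L2 wL2 eL2] : exists2 L2, bounded (m + n).+2 L2 &
    links (m + n).+2 L2 = bar (m + n) ∘ shift (shift (links (m + n) L)).
  exists ((0, 1) :: relabel S (relabel S L)).
    by apply: (@bounded_relabel (m + n).+1) => //; exact: (@bounded_relabel (m + n)).
  by rewrite -!links_shift.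
have eN : m.+1 + n.+1 = (m + n).+2 by rewrite addnS.
exists (relabel r L2).
  by rewrite eN; apply: bounded_relabel wL2 => i; exact: perm_ltn pv.
rewrite /normal_form !shiftM shift_unis -[shift (cous m n)]/(cous m.+1 n).
rewrite cousS -compA; congr (_ ∘ _).
have -> : cycle m.+1 n = tau (m + n) ∘ shift (cycle m n) by [].
have -> : unis m.+1 n.+1 = uni (m + n.+1) ∘ unis m n.+1 by [].
have := perm_links pv wL2; move: (relabel r L2) => L3 eL3.
rewrite -!compA (whisk (esym (cast_links _ _))) -compA.
have {}eL3 : shift (cycle m n) ∘ links (m + n).+2 L3 = links (m + n).+2 L2 ∘ shift (cycle m n).
  by rewrite -[RHS]comp1f -wv -!compA (compA v) eL3 -compA vw compf1.
rewrite (whisk eL3) eL2 -!compA (whisk (tau_bar _ _)).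
rewrite -(comp1f (shift _ ∘ _)) -(cou_bar_uni K (m + n)) -!compA; congr (_ ∘ (_ ∘ _)).
rewrite !(whisk (uni_nat _)) -!compA.
rewrite (whisk (uni_nat _)) -compA (whisk (uni_nat _)) -compA shift_cast.
by rewrite (eq_irrelevance (addnS m.+1 n) (congr1 S (addnS m n))).
Qed.

(** Composites of primitive arrows where [uni] and [cou] act on the leftmost
    position only: elsewhere they are obtained with [swap], by [tau_uni] and
    [cou_tau]. *)
Inductive word : forall n m, K n m -> Prop :=
| word_one n : word (one n)
| word_swap i n m (f : K n m) : i.+1 < m -> word f -> word (swap i m ∘ f)
| word_bar i n m (f : K n m) : i.+1 < m -> word f -> word (link i i.+1 m ∘ f)
| word_uni n m (f : K n m) : word f -> word (uni m ∘ f)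
| word_cou n m (f : K n m.+1) : word f -> word (cou m ∘ f).

Lemma word_comp n m k (g : K m k) (f : K n m) : word g -> word f -> word (g ∘ f).
Proof.
move=> wg; elim: wg n f => {m k g}
  [m|i m k g ik _ IH|i m k g ik _ IH|m k g _ IH|m k g _ IH] n f wordf.
- by rewrite comp1f.
- by rewrite -compA; apply: word_swap => //; exact: IH.
- by rewrite -compA; apply: word_bar => //; exact: IH.
- by rewrite -compA; apply: word_uni => //; exact: IH.
- by rewrite -compA; apply: word_cou => //; exact: IH.
Qed.

Lemma word_shift n m (f : K n m) : word f -> word (shift f).
Proof.
elim=> {n m f} [n|i n m f im _ IH|i n m f im _ IH|n m f _ IH|n m f _ IH].
- by rewrite shift1; exact: word_one.
- by rewrite shiftM; apply: (@word_swap i.+1).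
- by rewrite shiftM; apply: (@word_bar i.+1).
- by rewrite shiftM -tau_uni -compA; apply: (@word_swap 0) => //; exact: word_uni.
- by rewrite shiftM -cou_tau -compA; apply: word_cou; exact: (@word_swap 0).
Qed.

Lemma word_all n m (f : K n m) : word f.
Proof.
elim/strands_ind: n m / f => [n|n m k g f|n m f|n|n|n|n].
- exact: word_one.
- exact: word_comp.
- exact: word_shift.
- rewrite -(compf1 (tau n)); exact: (@word_swap 0) (word_one _).
- rewrite -(compf1 (bar n)); exact: (@word_bar 0) (word_one _).
- rewrite -(compf1 (uni n)); exact: word_uni (word_one _).
- rewrite -(compf1 (cou n)); exact: word_cou (word_one _).
Qed.

Lemma normal_form_one n : has_normal_form (one n).
Proof.
elim: n => [|n IH]; last by rewrite -shift1; exact: normal_form_shift.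
by exists [::]; rewrite // /normal_form /= !compf1.
Qed.

Lemma normal_form_all n m (f : K n m) : has_normal_form f.
Proof.
elim: (word_all f) => {n m f} [n|i n m f im _|i n m f im _|n m f _|n m f _].
- exact: normal_form_one.
- exact: normal_form_swap.
- exact: normal_form_bar.
- exact: normal_form_uni.
- exact: normal_form_cou.
Qed.

Lemma sem_link0 j n C D : j < n ->
  sem (link0 j n) C D <-> C = D /\ C 0 = C j.+1.
Proof.
elim: j n C D => [|j IH] [|n] C D //= jn; first by rewrite sem_bar.
have swapK' B : graph stau C B -> graph stau B C.
  by move=> ->; rewrite /graph; apply/funext => -[|[|k]].
rewrite !semM sem_tau sem_shift; split.
  move=> [B [[B' [CB' [B0 /IH[//|eB BjS]]]] BD]].
  have {BjS}eC : C 0 = C j.+2 by move: BjS; rewrite CB'.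
  have {B0 eB}eB : B' = B by rewrite -(scons_eta B') -(scons_eta B) B0 eB.
  by split=> //; rewrite BD -eB; exact: swapK'.
move=> [<- eC]; pose B := scons (C 1) (scons (C 0) (tl (tl C))).
by exists B; split; [exists B; split=> //; split=> //; apply/IH | exact: swapK'].
Qed.

Lemma sem_link i j n C D : i < n -> j < n ->
  sem (link i j n) C D <-> C = D /\ C i = C j.
Proof.
elim: i j n C D => [|i IH] [|j] [|n] C D //= lt_i lt_j.
- by rewrite sem1; split=> [->|[]].
- exact: sem_link0.
- by rewrite sem_link0 //; split=> -[].
rewrite sem_shift; split=> [[C0 /IH[//|//|eC Cij]]|[<- Cij]].
  by split=> //; rewrite -(scons_eta C) -(scons_eta D) C0 eC.
by split=> //; apply/IH.
Qed.

Lemma sem_links n L C D : bounded n L ->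
  sem (links n L) C D <-> C = D /\ {in L, forall p, C p.1 = C p.2}.
Proof.
elim: L C D => [|p L IH] C D /=; first by rewrite sem1; split=> [->|[]].
move=> /andP[/andP[p1 p2] /[dup] wL /IH{}IH]; rewrite semM; split.
  move=> [B [/IH[<- CL] /sem_link[//|//|<- Cp]]]; split=> // q.
  by rewrite inE => /orP[/eqP->|/CL].
move=> [<- CL]; exists C; split.
  by apply/IH; split=> // q qL; apply: CL; rewrite inE qL orbT.
by apply/sem_link => //; split=> //; apply: CL; rewrite mem_head.
Qed.

Lemma sem_unis m n C D : sem (unis m n) C D <-> C = (fun k => D (m + k)).
Proof.
elim: m C D => [|m IH] C D /=; first by rewrite sem1; split=> ->.
rewrite semM sem_uni; split=> [[B [/IH-> ->]] //|->].
by exists (tl D); split=> //; apply/IH.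
Qed.

Lemma sem_cous m n C D : sem (cous m n) C D <->
  (forall k, k < m -> C k = D k) /\ (forall k, C (m + n + k) = D (m + k)).
Proof.
elim: m C D => [|m IH] C D /=.
  elim: n C D => [|n IH] C D /=.
    rewrite sem1; split=> [->//|[_ e]].
    exact/esym/funext.
  rewrite semM sem_cou; split=> [[B [-> /IH[_ e]]]|[_ e]]; first by split.
  by exists (tl C); split=> //; apply/IH; split.
rewrite sem_shift; split=> [[C0 /IH[lo hi]]|[lo hi]].
  by split=> // -[|k] //=; exact: lo.
by split; [exact: lo | apply/IH; split=> [k km|k]; [exact: (lo k.+1) | exact: hi]].
Qed.

(** The colouring of the [m + n] strands of a normal form that extends the
    colourings [D] of its target and [C] of its source. *)
Definition paste m (D C : stream) : stream :=
  fun k => if k < m then D k else C (k - m).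

Lemma sem_normal_form n m L C D : bounded (m + n) L ->
  sem (normal_form n m L) C D <->
  (forall k, C (n + k) = D (m + k)) /\
  {in L, forall p, paste m D C p.1 = paste m D C p.2}.
Proof.
move=> wL; rewrite /normal_form !semM; split.
  move=> [B [[B' [/sem_unis eC /sem_links[] // eB BL]] /sem_cous[lo hi]]].
  subst B' C; have -> : paste m D (fun k => B (m + k)) = B.
    apply/funext => k; rewrite /paste; case: ltnP => km; first by rewrite lo.
    by rewrite subnKC.
  by split=> // k; rewrite -hi addnA.
move=> [tails CL]; exists (paste m D C); split.
  exists (paste m D C); split; last exact/sem_links.
  apply/sem_unis; apply/funext => k.
  by rewrite /paste ltnNge leq_addr addKn.
apply/sem_cous; split=> [k km|k]; first by rewrite /paste km.
by rewrite -tails /paste -addnA ltnNge leq_addr addKn.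
Qed.

(** * Isomorphism with the category of split equivalences *)

Definition pos n m (x : 'I_n + 'I_m) : nat :=
  match x with inl a => m + a | inr b => b end.

Lemma ltn_pos n m (x : 'I_n + 'I_m) : pos x < m + n.
Proof. by case: x => a /=; rewrite ?ltn_add2l ?ltn_addr. Qed.

Lemma pos_onto n m k : k < m + n -> exists x : 'I_n + 'I_m, pos x = k.
Proof.
move=> kmn; have [km|mk] := ltnP k m; first by exists (inr (Ordinal km)).
have kn : k - m < n by rewrite ltn_subLR.
by exists (inl (Ordinal kn)); rewrite /= subnKC.
Qed.

Definition restr n (C : stream) : pred 'I_n := fun i => C i.
Definition ext n (c : pred 'I_n) : stream := fun k => oapp c false (insub k).

Lemma extK n (c : pred 'I_n) : restr (ext c) = c.
Proof. by apply/funext => i; rewrite /restr /ext valK. Qed.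

Lemma ext_tail n (c : pred 'I_n) k : ext c (n + k) = false.
Proof. by rewrite /ext insubN // -leqNgt leq_addr. Qed.

Lemma colour_paste n m C D (x : 'I_n + 'I_m) :
  colour (restr C) (restr D) x = paste m D C (pos x).
Proof.
case: x => a; rewrite /paste /=; first by rewrite ltnNge leq_addr addKn.
by rewrite ltn_ord.
Qed.

(** Two points are related when no pair of colourings in the relation of [f]
    separates them. *)
Definition gen_set n m (f : K n m) : {set ('I_n + 'I_m) * ('I_n + 'I_m)} :=
  [set p | `[< forall C D, sem f C D ->
     colour (restr C) (restr D) p.1 = colour (restr C) (restr D) p.2 >]].

Lemma gen_set_equiv n m (f : K n m) : is_equivalence (gen_set f).
Proof.
apply/is_equivalenceP; split=> [x|x y|x y z]; rewrite !inE.
- exact/asboolP.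
- by move=> /asboolP h; apply/asboolP => C D /h.
- by move=> /asboolP h /asboolP h'; apply/asboolP => C D CD; rewrite (h _ _ CD) h'.
Qed.

Definition gen_of n m (f : K n m) : split_equiv n m :=
  exist _ (gen_set f) (gen_set_equiv f).

(** From right to left the normal form is needed: it shows that the relation of
    [f] consists of all the colourings constant on the classes of some
    equivalence. *)
Lemma semE n m (f : K n m) C D : sem f C D <->
  (forall k, C (n + k) = D (m + k)) /\ agree (gen_of f) (restr C) (restr D).
Proof.
split=> [CD|[tails ag]].
  split; last by move=> x y /=; rewrite inE => /asboolP; exact.
  by have [L wL ef] := normal_form_all f; move: CD; rewrite ef => /sem_normal_form[].
have [L wL ef] := normal_form_all f; rewrite ef; apply/sem_normal_form => //; split=> // p pL.
have /andP[/pos_onto[x ex] /pos_onto[y ey]] := allP wL _ pL.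
rewrite -ex -ey -!colour_paste; apply: ag; rewrite inE; apply/asboolP => C' D' /=.
by rewrite !colour_paste ex ey ef => /(sem_normal_form _ _ wL)[_]; exact.
Qed.

Lemma agree_gen_of n m (f : K n m) c d :
  agree (gen_of f) c d <-> sem f (ext c) (ext d).
Proof.
rewrite semE !extK; split=> [ag|[]//].
by split=> // k; rewrite !ext_tail.
Qed.

Lemma gen_of_one n : gen_of (one n) = gen_id n.
Proof.
apply: agree_inj => c d; rewrite agree_gen_of agree_id sem1; split=> [e i|/funext->//].
have {}e : ext d = ext c := e.
by rewrite -(extK c) -e extK.
Qed.

Lemma gen_of_comp n m k (g : K m k) (f : K n m) :
  gen_of (g ∘ f) = gen_cmp (gen_of g) (gen_of f).
Proof.
apply: agree_inj => c e; rewrite agree_gen_of agree_cmp semM.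
split=> [[B [fB gB]]|[d [/agree_gen_of fd /agree_gen_of ge]]]; last by exists (ext d).
exists (restr B); move: fB gB => /semE[_ fB] /semE[_ gB].
by rewrite !extK in fB gB.
Qed.

(** Every colouring of the [m + n] strands occurs as [paste m D C], so that equal
    relations allow the same colourings of the links, and [links_eq] applies. *)
Lemma gen_of_inj n m : injective (@gen_of n m).
Proof.
move=> f g efg.
have {efg} : forall C D, sem f C D <-> sem g C D by move=> C D; rewrite !semE efg.
have [[L wL ->] [L' wL' ->]] := (normal_form_all f, normal_form_all g) => e.
rewrite /normal_form (links_eq wL wL') // => B.
(* Beyond the target strands, [D] continues with the tail of [C]. *)
pose C k := B (m + k); pose D k := if k < m then B k else B (n + k).
have eB : paste m D C = B.
  by apply/funext => k; rewrite /paste /C /D; case: ltnP => // mk; rewrite subnKC.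
have tails k : C (n + k) = D (m + k).
  by rewrite /C /D ltnNge leq_addr /= addnCA.
have [e1 e2] := e C D; rewrite -eB; split=> BL.
  by have /sem_normal_form[] := e1 (proj2 (sem_normal_form _ _ wL) (conj tails BL)).
by have /sem_normal_form[] := e2 (proj2 (sem_normal_form _ _ wL') (conj tails BL)).
Qed.

Lemma gen_of_surj n m (P : split_equiv n m) : exists f : K n m, gen_of f = P.
Proof.
pose L := [seq (pos p.1, pos p.2) | p <- enum (val P)].
have wL : bounded (m + n) L.
  by apply/allP => q /mapP[p _ ->]; rewrite /= !ltn_pos.
exists (normal_form n m L); apply: agree_inj => c d.
rewrite agree_gen_of sem_normal_form //; split=> [[_ h] x y xy|ag].
  have := h (pos x, pos y); rewrite /= -!colour_paste !extK; apply.
  by apply/mapP; exists (x, y); rewrite ?mem_enum.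
split=> [k|q /mapP[[x y]]]; first by rewrite !ext_tail.
rewrite mem_enum => xy -> /=; rewrite -!colour_paste !extK; exact: ag.
Qed.

End Theory.

Definition strands_cat (K : strands) : category :=
  @Category nat K (@one K) (@comp K) (@comp1f K) (@compf1 K) (@compA K).

Lemma functor_eq (C D : category) (o : obj C -> obj D) m1 m2 p1 p2 q1 q2 :
  m1 = m2 -> @Functor C D o m1 p1 q1 = @Functor C D o m2 p2 q2.
Proof.
by move=> e; subst m2; congr Functor; exact: Prop_irrelevance.
Qed.

Lemma strands_iso (K : strands) : isomorphic (strands_cat K) Gen.
Proof.
pose G n m (P : split_equiv n m) : K n m := projT1 (cid (gen_of_surj K P)).
have GK n m (P : split_equiv n m) : gen_of (G n m P) = P by rewrite /G; case: cid.
have KG n m (f : K n m) : G n m (gen_of f) = f by apply: gen_of_inj; rewrite GK.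
have G1 n : G n n (gen_id n) = one n by rewrite -(gen_of_one K).
have GM n m k (Q : split_equiv m k) (P : split_equiv n m) :
  G n k (gen_cmp Q P) = G m k Q ∘ G n m P by apply: gen_of_inj; rewrite gen_of_comp !GK.
exists (@Functor (strands_cat K) Gen id (@gen_of K) (@gen_of_one K) (@gen_of_comp K)).
exists (@Functor Gen (strands_cat K) id G G1 GM).
by split; apply: functor_eq; do 3 (apply: functional_extensionality_dep => ?) => /=.
Qed.

Lemma isomorphic_sym C D : isomorphic C D -> isomorphic D C.
Proof. by move=> [F [G [GF FG]]]; exists G, F. Qed.

Lemma functor_compA (A B C D : category) (H : functor C D) (G : functor B C)
    (F : functor A B) :
  functor_comp H (functor_comp G F) = functor_comp (functor_comp H G) F.
Proof. exact: functor_eq. Qed.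

Lemma functor_comp1F (C D : category) (F : functor C D) :
  functor_comp (functor_id D) F = F.
Proof. by case: F => *; exact: functor_eq. Qed.

Lemma isomorphic_trans C D E : isomorphic C D -> isomorphic D E -> isomorphic C E.
Proof.
move=> [F [G [GF FG]]] [F' [G' [GF' FG']]].
exists (functor_comp F' F), (functor_comp G G'); split.
  by rewrite -functor_compA (functor_compA G') GF' functor_comp1F.
by rewrite -functor_compA (functor_compA F) FG functor_comp1F.
Qed.

(** * The free equivalential Frobenius monad *)

Fixpoint ef_sem n m (f : ef_term n m) : srel :=
  match f with
  | ef_id _ => graph id
  | ef_nabla _ => cograph sdup
  | ef_Delta _ => graph sdup
  | ef_u _ => cograph tl
  | ef_eps _ => graph tl
  | ef_tau _ => graph stau
  | ef_comp _ _ _ g f => rcmp (ef_sem g) (ef_sem f)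
  | ef_M _ _ f => rlift (ef_sem f)
  end.

Lemma ef_sound n m (f g : ef_term n m) : ef_eq f g -> ef_sem f = ef_sem g.
Proof.
elim=> {n m f g} //=.
- by move=> n m f g h _ -> _ ->.
- by move=> n m k g g' f f' _ -> _ ->.
- by move=> n m f g _ ->.
- by move=> n m f; rewrite rcmp1.
- by move=> n m f; rewrite rcmpr1.
- by move=> *; rewrite rcmpA.
- by move=> n; exact: rlift1.
- by move=> *; exact: rliftM.
- by move=> *; exact: rnab_nat.
- by move=> *; exact: rdel_nat.
- by move=> *; exact: runi_nat.
- by move=> *; exact: rcou_nat.
- by move=> *; exact: rtau_nat.
- by move=> n; by_cographs.
- by move=> n; by_cographs.
- by move=> n; by_cographs.
- by move=> n; by_graphs.
- by move=> n; by_graphs.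
- by move=> n; by_graphs.
- by move=> n; exact: rfrob_l.
- by move=> n; rewrite rfrob_r.
- by move=> n; exact: rtauK.
- by move=> n; exact: rtau_braid.
- by move=> n; by_cographs.
- by move=> n; by_graphs.
- by move=> n; exact: rtau_nabM.
- by move=> n; exact: rdelM_tau.
- by move=> n; exact: rtau_uni.
- by move=> n; exact: rcou_tau.
- by move=> n; exact: rnab_del.
- by move=> n; exact: rcou_uni.
Qed.

Section EFstrands.
Local Notation K := (@arrow EF_presentation).
Local Notation "[| t |]" := (@arrow_of EF_presentation _ _ t).
Local Notation "g ∙ f" := (arrow_cmp g f) (at level 40, left associativity).
Implicit Types n m k : nat.

Lemma arrowP (S : presentation) (a b : pobj S) (f : arrow a b) :
  exists t : @term S a b, f = arrow_of t.
Proof. by exists (repr f); exact/esym/reprK. Qed.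

Let E n m (f g : ef_term n m) (e : ef_eq f g) : [| f |] = [| g |] :=
  proj2 (@arrow_ofP EF_presentation n m f g) e.

Let reprE n m (t : ef_term n m) : ef_eq (repr [| t |]) t :=
  proj1 (@arrow_ofP EF_presentation n m _ t) (reprK _).

Definition ef_shift n m (f : K n m) : K n.+1 m.+1 := [| ef_M (repr f) |].

Lemma ef_shiftE n m (t : ef_term n m) : ef_shift [| t |] = [| ef_M t |].
Proof. exact: E (ef_M_congr (reprE t)). Qed.

Local Notation one n := [| ef_id n |].
Local Notation tau n := [| ef_tau n |].
Local Notation nab n := [| ef_nabla n |].
Local Notation del n := [| ef_Delta n |].
Local Notation uni n := [| ef_u n |].
Local Notation cou n := [| ef_eps n |].
Local Notation cmpA := (@arrow_cmpA EF_presentation).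
Local Notation cmp1f := (@arrow_cmp1m EF_presentation).
Local Notation cmpf1 := (@arrow_cmpm1 EF_presentation).

Let cmpE := (@arrow_cmpE EF_presentation, ef_shiftE).
Ltac by_axiom := rewrite !cmpE; apply: E; constructor.

Lemma ef_shiftM n m k (g : K m k) (f : K n m) :
  ef_shift (g ∙ f) = ef_shift g ∙ ef_shift f.
Proof.
have [[t ->] [t' ->]] := (arrowP g, arrowP f).
by by_axiom.
Qed.

Definition ef_rel n m (f : K n m) : srel := ef_sem (repr f).

Lemma ef_relE n m (t : ef_term n m) : ef_rel [| t |] = ef_sem t.
Proof. exact: ef_sound (reprE t). Qed.

(** Two strands are linked by merging them and splitting the result again. *)
Definition ef_bar n : K n.+2 n.+2 := del n ∙ nab n.

Lemma ef_nat n m (f : K n m) : [/\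
  tau m ∙ ef_shift (ef_shift f) = ef_shift (ef_shift f) ∙ tau n,
  ef_bar m ∙ ef_shift (ef_shift f) = ef_shift (ef_shift f) ∙ ef_bar n,
  uni m ∙ f = ef_shift f ∙ uni n & cou m ∙ ef_shift f = f ∙ cou n].
Proof.
have [t ->] := arrowP f; split; try by by_axiom.
have e1 : nab m ∙ ef_shift (ef_shift [| t |]) = ef_shift [| t |] ∙ nab n by by_axiom.
have e2 : del m ∙ ef_shift [| t |] = ef_shift (ef_shift [| t |]) ∙ del n by by_axiom.
by rewrite /ef_bar -cmpA e1 cmpA e2 -cmpA.
Qed.

Lemma ef_nab_del n : nab n ∙ del n = one n.+1.
Proof. by by_axiom. Qed.

Lemma ef_bar_bar n : ef_bar n ∙ ef_bar n = ef_bar n.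
Proof. by rewrite /ef_bar -cmpA (cmpA (nab n)) ef_nab_del cmp1f. Qed.

Lemma ef_tauK n : tau n ∙ tau n = one n.+2.
Proof. by by_axiom. Qed.

Lemma ef_shift1 n : ef_shift (one n) = one n.+1.
Proof. by by_axiom. Qed.

Lemma ef_tau_bar_tau n :
  ef_shift (tau n) ∙ (ef_bar n.+1 ∙ ef_shift (tau n))
  = tau n.+1 ∙ (ef_shift (ef_bar n) ∙ tau n.+1).
Proof.
have MK : ef_shift (tau n) ∙ ef_shift (tau n) = one n.+3.
  by rewrite -ef_shiftM ef_tauK ef_shift1.
have e1 : nab n.+1 ∙ ef_shift (tau n) = tau n ∙ (ef_shift (nab n) ∙ tau n.+1).
  have e : tau n ∙ nab n.+1 = ef_shift (nab n) ∙ tau n.+1 ∙ ef_shift (tau n) by by_axiom.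
  by rewrite -[LHS]cmp1f -ef_tauK -!cmpA (cmpA (tau n) (nab _)) e -!cmpA MK cmpf1.
have e2 : ef_shift (tau n) ∙ del n.+1 = tau n.+1 ∙ (ef_shift (del n) ∙ tau n).
  have e : del n.+1 ∙ tau n = ef_shift (tau n) ∙ tau n.+1 ∙ ef_shift (del n) by by_axiom.
  by rewrite -[LHS]cmpf1 -ef_tauK -!cmpA (cmpA (del _) (tau _)) e -!cmpA !cmpA MK cmp1f.
rewrite /ef_bar ef_shiftM -!cmpA e1 cmpA e2 -!cmpA.
by rewrite (cmpA (tau n) (tau n)) ef_tauK cmp1f.
Qed.

Lemma ef_bar_absorb n : tau n ∙ ef_bar n = ef_bar n /\ ef_bar n ∙ tau n = ef_bar n.
Proof.
have e1 : nab n ∙ tau n = nab n by by_axiom.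
have e2 : tau n ∙ del n = del n by by_axiom.
by rewrite /ef_bar cmpA e2 -cmpA e1.
Qed.

Lemma ef_cou_bar n : cou n.+1 ∙ ef_bar n = nab n.
Proof.
have e : cou n.+1 ∙ del n = one n.+1 by by_axiom.
by rewrite cmpA e cmp1f.
Qed.

Lemma ef_bar_uni n : ef_bar n ∙ uni n.+1 = del n.
Proof.
have e : nab n ∙ uni n.+1 = one n.+1 by by_axiom.
by rewrite -cmpA e cmpf1.
Qed.

Lemma ef_bar_comm n :
  ef_shift (ef_bar n) ∙ ef_bar n.+1 = ef_bar n.+1 ∙ ef_shift (ef_bar n).
Proof.
have f1 : ef_shift (nab n) ∙ del n.+1 = del n ∙ nab n by by_axiom.
have f2 : nab n.+1 ∙ ef_shift (del n) = del n ∙ nab n by apply/esym; by_axiom.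
have a1 : nab n ∙ nab n.+1 = nab n ∙ ef_shift (nab n) by by_axiom.
have a2 : ef_shift (del n) ∙ del n = del n.+1 ∙ del n by apply/esym; by_axiom.
rewrite /ef_bar ef_shiftM -!cmpA.
rewrite (cmpA (ef_shift (nab n))) f1 (cmpA (nab n.+1)) f2.
by rewrite -!cmpA a1 !cmpA a2.
Qed.

(** [Δ] and [∇] are composites of the other generators by [ef_cou_bar] and
    [ef_bar_uni], so that the arrows of EF are generated as required. *)
Definition EF_strands : strands.
Proof.
apply: (@Strands K (fun n => one n) (@arrow_cmp EF_presentation)
  cmp1f cmpf1 cmpA ef_shift ef_shift1 ef_shiftM
  (fun n => tau n) ef_bar (fun n => uni n) (fun n => cou n)
  _ _ _ _ ef_tauK _ _ _ _ ef_bar_bar ef_tau_bar_tau _ _ _ ef_bar_comm _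
  ef_rel).
- by move=> n m f; case: (ef_nat f).
- by move=> n m f; case: (ef_nat f).
- by move=> n m f; case: (ef_nat f).
- by move=> n m f; case: (ef_nat f).
- by move=> n; rewrite !cmpA; by_axiom.
- by move=> n; by_axiom.
- by move=> n; by_axiom.
- by move=> n; by_axiom.
- by move=> n; case: (ef_bar_absorb n).
- by move=> n; case: (ef_bar_absorb n).
- by move=> n; rewrite cmpA ef_cou_bar; by_axiom.
- move=> P P1 PM PS Ptau Pbar Puni Pcou n m f; have [t ->] := arrowP f.
  elim: t => {n m f} [n|n|n|n|n|n|n m k g Pg f Pf|n m f Pf].
  + exact: P1.
  + by rewrite -ef_cou_bar; exact: PM.
  + by rewrite -ef_bar_uni; exact: PM.
  + exact: Puni.
  + exact: Pcou.
  + exact: Ptau.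
  + by rewrite -arrow_cmpE; exact: PM.
  + by rewrite -ef_shiftE; exact: PS.
- by move=> n; exact: ef_relE.
- move=> n m k g f; have [[t ->] [t' ->]] := (arrowP g, arrowP f).
  by rewrite cmpE !ef_relE.
- by move=> n m f; have [t ->] := arrowP f; rewrite cmpE !ef_relE.
- by move=> n; exact: ef_relE.
- by move=> n; rewrite /ef_bar cmpE ef_relE /= -rbarE.
- by move=> n; exact: ef_relE.
- by move=> n; exact: ef_relE.
Defined.

End EFstrands.

Lemma EF_Gen : isomorphic EF Gen.
Proof. exact: strands_iso EF_strands. Qed.

(** * The syntactic category with linking arrows *)

Definition eh_gen_sem (th : eh_gen) : srel :=
  match th with
  | Hone => graph id
  | Hu => cograph tl
  | Heps => graph tl
  | Htau => graph stau
  | Hbar => rbar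
  end.

Fixpoint eh_sem (f : eh_term) : srel :=
  match f with
  | eh_prim n th _ => iter n rlift (eh_gen_sem th)
  | eh_comp g f => rcmp (eh_sem g) (eh_sem f)
  end.

Lemma iter_rliftM n R S :
  iter n rlift (rcmp S R) = rcmp (iter n rlift S) (iter n rlift R).
Proof. by elim: n => //= n ->; exact: rliftM. Qed.

Lemma eh_sem_shift n f m : eh_sem (eh_shift n f m) = iter n rlift (eh_sem f).
Proof.
elim: f => [k th l|g IHg f IHf] /=; first by rewrite iterD.
by rewrite IHg IHf iter_rliftM.
Qed.

Lemma eh_gen_sem_nat (xi : eh_gen) R :
  rcmp (eh_gen_sem xi) (iter (eh_src xi) rlift R)
  = rcmp (iter (eh_tgt xi) rlift R) (eh_gen_sem xi).
Proof.
case: xi => /=.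
- by rewrite rcmp1 rcmpr1.
- exact: runi_nat.
- exact: rcou_nat.
- exact: rtau_nat.
- exact: rbar_nat.
Qed.

Lemma eh_sound a b f g : eh_eq a b f g -> eh_sem f = eh_sem g.
Proof.
elim=> {a b f g} //=.
- by move=> a b f g h _ -> _ ->.
- by move=> a b c g g' f f' _ -> _ ->.
- by move=> n m a b f g _ e; rewrite !eh_sem_shift e.
- by move=> a b f _; rewrite rcmp1.
- by move=> a b f _; rewrite rcmpr1.
- by move=> *; rewrite rcmpA.
- exact: rlift1.
- by move=> xi th r _ _; rewrite !iterD eh_gen_sem_nat.
- exact: rtauK.
- exact: rtau_braid.
- exact: rtau_uni.
- exact: rcou_tau.
- exact: rcou_uni.
- exact: rbar_bar.
- exact: rtau_bar_tau.
- exact: rtau_bar.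
- by rewrite rbar_tau.
- exact: rcou_bar_uni.
- exact: rbar_comm.
Qed.

Section EFHstrands.
Local Notation K := (@arrow EFH_presentation).
Local Notation "g ∙ f" := (arrow_cmp g f) (at level 40, left associativity).
Local Notation cmpA := (@arrow_cmpA EFH_presentation).

Definition eh_arr a b f (h : eh_typed a b f) : K a b :=
  @arrow_of EFH_presentation a b (exist _ f h).

Lemma eh_arr_eq a b f g (hf : eh_typed a b f) (hg : eh_typed a b g) :
  eh_eq a b f g -> eh_arr hf = eh_arr hg.
Proof. by move=> e; apply/(@arrow_ofP EFH_presentation). Qed.

Lemma eh_arrP a b (x : K a b) : exists f (h : eh_typed a b f), x = eh_arr h.
Proof. by have [[f h] ->] := arrowP x; exists f, h. Qed.

Lemma eh_arrM a b c g f (hg : eh_typed b c g) (hf : eh_typed a b f) :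
  eh_arr hg ∙ eh_arr hf = eh_arr (typed_comp hg hf).
Proof. by rewrite /eh_arr (@arrow_cmpE EFH_presentation). Qed.

Lemma eh_shift_typed1 a b f : eh_typed a b f -> eh_typed a.+1 b.+1 (eh_shift 1 f 0).
Proof. by move=> /(eh_shift_typed 1 0); rewrite !addn0. Qed.

Lemma eh_shift_congr1 a b f g : eh_eq a b f g ->
  eh_eq a.+1 b.+1 (eh_shift 1 f 0) (eh_shift 1 g 0).
Proof. by move=> /(eh_shift_congr 1 0); rewrite !addn0. Qed.

Definition eh_lift a b (x : K a b) : K a.+1 b.+1 :=
  eh_arr (eh_shift_typed1 (proj2_sig (repr x))).

Lemma eh_liftE a b f (h : eh_typed a b f) : eh_lift (eh_arr h) = eh_arr (eh_shift_typed1 h).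
Proof.
apply: eh_arr_eq; apply: eh_shift_congr1.
exact: (proj1 (@arrow_ofP EFH_presentation a b _ (exist _ f h)) (reprK _)).
Qed.

Definition eh_cell th n : K (eh_src th + n) (eh_tgt th + n) := eh_arr (typed_prim 0 th n).
Definition eh_one n : K n n := eh_arr (eh_id_typed n).
Local Notation tau := (eh_cell Htau : forall n, K n.+2 n.+2).
Local Notation bar := (eh_cell Hbar : forall n, K n.+2 n.+2).
Local Notation uni := (eh_cell Hu : forall n, K n n.+1).
Local Notation cou := (eh_cell Heps : forall n, K n.+1 n).

Lemma eh_oneE k m : eh_eq (k + m) (k + m) (eh_prim k Hone m) (eh_id (k + m)).
Proof.
elim: k m => [|k IH] m; first by apply: eh_refl; exact: eh_id_typed.
have := eh_shift_congr1 (IH m); rewrite /= !addn0 => /eh_trans; apply.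
exact: (eh_shift_congr 0 (k + m) eh_shift_id).
Qed.

Lemma eh_shift_shift p q f : eh_shift p (eh_shift q f 0) 0 = eh_shift (p + q) f 0.
Proof.
by elim: f => [k th l|g IHg f IHf] /=; rewrite ?IHg ?IHf // !addn0 addnA.
Qed.

Lemma eh_shift_typed0 k a b f : eh_typed a b f -> eh_typed (k + a) (k + b) (eh_shift k f 0).
Proof. by move=> /(eh_shift_typed k 0); rewrite !addn0. Qed.

(** Naturality extends the interchange equations from primitive terms to all
    terms, by induction on the term; these equations exclude identities, which
    are dealt with by [eh_oneE]. *)
Lemma eh_nat xi a b f : xi <> Hone -> eh_typed a b f ->
  eh_eq (eh_src xi + a) (eh_tgt xi + b)
    (eh_comp (eh_prim 0 xi b) (eh_shift (eh_src xi) f 0))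
    (eh_comp (eh_shift (eh_tgt xi) f 0) (eh_prim 0 xi a)).
Proof.
move=> nxi; have tx n := typed_prim 0 xi n.
elim=> {a b f} [k th l|a b c g f tg IHg tf IHf]; last first.
  have tsf := eh_shift_typed0 (eh_src xi) tf; have ttf := eh_shift_typed0 (eh_tgt xi) tf.
  have tsg := eh_shift_typed0 (eh_src xi) tg; have ttg := eh_shift_typed0 (eh_tgt xi) tg.
  apply: (eh_trans (eh_compA (tx c) tsg tsf)).
  apply: (eh_trans (eh_comp_congr IHg (eh_refl tsf))).
  apply: (eh_trans (eh_sym (eh_compA ttg (tx b) tsf))).
  apply: (eh_trans (eh_comp_congr (eh_refl ttg) IHf)).
  exact: eh_compA ttg ttf (tx a).
have [->|nth] : th = Hone \/ th <> Hone by case: th; (by left) || by right.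
  rewrite /= !addn0.
  have e p : eh_eq (p + (k + l)) (p + (k + l)) (eh_prim (p + k) Hone l) (eh_id (p + (k + l))).
    by rewrite addnA; exact: eh_oneE.
  apply: (eh_trans (eh_comp_congr (eh_refl (tx _)) (e _))).
  apply: (eh_trans (eh_comp_id (tx _))).
  apply: eh_sym; apply: (eh_trans (eh_comp_congr (e _) (eh_refl (tx _)))).
  exact: eh_id_comp (tx _).
have := eh_shift_congr 0 l (eh_sym (eh_interchange k nxi nth)).
by rewrite /= !addn0 !add0n !addnA.
Qed.

Lemma eh_lift1 n : eh_lift (eh_one n) = eh_one n.+1.
Proof.
rewrite eh_liftE; apply: eh_arr_eq => /=; rewrite !addn0.
exact: (eh_shift_congr 0 n eh_shift_id).
Qed.

Lemma eh_liftM n m k (g : K m k) (f : K n m) :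
  eh_lift (g ∙ f) = eh_lift g ∙ eh_lift f.
Proof.
have [[t [ht ->]] [s [hs ->]]] := (eh_arrP g, eh_arrP f).
by rewrite eh_arrM !eh_liftE eh_arrM; apply: eh_arr_eq; apply: eh_refl;
  exact: eh_shift_typed1 (typed_comp ht hs).
Qed.

Lemma eh_lift_nat n m (f : K n m) : [/\
  tau m ∙ eh_lift (eh_lift f) = eh_lift (eh_lift f) ∙ tau n,
  bar m ∙ eh_lift (eh_lift f) = eh_lift (eh_lift f) ∙ bar n,
  uni m ∙ f = eh_lift f ∙ uni n & cou m ∙ eh_lift f = f ∙ cou n].
Proof.
have [t [ht ->]] := eh_arrP f; rewrite !eh_liftE.
have e0 : eh_shift 0 t 0 = t.
  by elim: {ht} t => [k th l|g IHg h IHh] /=; rewrite ?IHg ?IHh ?addn0.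
split; rewrite !eh_arrM; apply: eh_arr_eq; rewrite ?eh_shift_shift.
- exact: (@eh_nat Htau).
- exact: (@eh_nat Hbar).
- have /(_ _ _ _ _ ht) := @eh_nat Hu; rewrite /= e0; exact.
- have /(_ _ _ _ _ ht) := @eh_nat Heps; rewrite /= e0; exact.
Qed.

Lemma eh_arr_ind (P : forall n m, K n m -> Prop) :
  (forall n, P n n (eh_one n)) ->
  (forall n m k (g : K m k) (f : K n m), P m k g -> P n m f -> P n k (g ∙ f)) ->
  (forall n m (f : K n m), P n m f -> P n.+1 m.+1 (eh_lift f)) ->
  (forall th n, th <> Hone -> P _ _ (eh_cell th n)) ->
  forall n m (f : K n m), P n m f.
Proof.
move=> P1 PM PS Pcell n m f; have [t [ht ->]] := eh_arrP f.
have irr a b g (h h' : eh_typed a b g) : P a b (eh_arr h) -> P a b (eh_arr h').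
  by rewrite (eh_arr_eq h h') //; exact: eh_refl.
move: (ht); elim: ht => {n m f t} [k th l|a b c g f hg Pg hf Pf] h; last first.
  by apply: (irr _ _ _ (typed_comp hg hf)); rewrite -eh_arrM; apply: PM; [exact: Pg | exact: Pf].
apply: (irr _ _ _ (typed_prim k th l)).
elim: k h => [|k IH] h.
  have [e|] : th = Hone \/ th <> Hone by case: (th); (by left) || by right.
    by subst th; exact: (irr _ _ _ (eh_id_typed l) _ (P1 l)).
  exact: Pcell.
have /PS := IH (typed_prim k th l).
rewrite eh_liftE; congr P; apply: eh_arr_eq; rewrite /= addn0.
exact: eh_refl (typed_prim k.+1 th l).
Qed.

Definition eh_rel n m (f : K n m) : srel := eh_sem (proj1_sig (repr f)).

Lemma eh_relE n m t (h : eh_typed n m t) : eh_rel (eh_arr h) = eh_sem t.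
Proof.
apply: eh_sound.
exact: (proj1 (@arrow_ofP EFH_presentation n m _ (exist _ t h)) (reprK _)).
Qed.

(** A term naming an arrow, the typing proof being left out.  It is inferred
    along the structure of the arrow, after which the right subscripts of the
    form [n + 0] can be simplified in the bare terms. *)
Definition names a b (f : eh_term) (x : K a b) : Prop :=
  exists h : eh_typed a b f, x = eh_arr h.

Lemma names_cell th n : names (eh_prim 0 th n) (eh_cell th n).
Proof. by exists (typed_prim 0 th n). Qed.

Lemma names_one n : names (eh_id n) (eh_one n).
Proof. by exists (eh_id_typed n). Qed.

Lemma names_comp a b c g f (y : K b c) (x : K a b) :
  names g y -> names f x -> names (eh_comp g f) (y ∙ x).
Proof. by move=> [hg ->] [hf ->]; exists (typed_comp hg hf); rewrite eh_arrM. Qed.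

Lemma names_lift a b f (x : K a b) : names f x -> names (eh_shift 1 f 0) (eh_lift x).
Proof. by move=> [h ->]; exists (eh_shift_typed1 h); rewrite eh_liftE. Qed.

Lemma names_eq a b f g (x y : K a b) :
  names f x -> names g y -> eh_eq a b f g -> x = y.
Proof. by move=> [hf ->] [hg ->]; exact: eh_arr_eq. Qed.

Ltac name_it := repeat
  (eapply names_comp || eapply names_lift || exact: (names_cell Htau) || exact: (names_cell Hbar) ||
   exact: (names_cell Hu) || exact: (names_cell Heps) || eapply names_one).

Ltac by_relation e n := rewrite ?cmpA; eapply names_eq;
  [by name_it | by name_it | rewrite /= ?addn0; exact: (eh_shift_congr 0 n e)].

Definition EFH_strands : strands.
Proof.
apply: (@Strands K eh_one (@arrow_cmp EFH_presentation)
  (@arrow_cmp1m EFH_presentation) (@arrow_cmpm1 EFH_presentation)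
  (@arrow_cmpA EFH_presentation) eh_lift eh_lift1 eh_liftM tau bar uni cou
  _ _ _ _ _ _ _ _ _ _ _ _ _ _ _ _ eh_rel).
- by move=> n m f; case: (eh_lift_nat f).
- by move=> n m f; case: (eh_lift_nat f).
- by move=> n m f; case: (eh_lift_nat f).
- by move=> n m f; case: (eh_lift_nat f).
- by move=> n; by_relation eh_tau_tau n.
- by move=> n; by_relation eh_tau_braid n.
- by move=> n; by_relation eh_tau_u n.
- by move=> n; by_relation eh_eps_tau n.
- by move=> n; by_relation eh_eps_u n.
- by move=> n; by_relation eh_H_H n.
- by move=> n; by_relation eh_tau_H_tau n.
- by move=> n; by_relation eh_tau_H n.
- by move=> n; by_relation (eh_sym eh_H_tau) n.
- by move=> n; by_relation eh_eps_H_u n.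
- by move=> n; by_relation eh_H_comm n.
- move=> P P1 PM PS Ptau Pbar Puni Pcou.
  apply: (eh_arr_ind P1 PM PS); case=> n nth.
  + by case: nth.
  + exact: Puni.
  + exact: Pcou.
  + exact: Ptau.
  + exact: Pbar.
- by move=> n; exact: eh_relE.
- move=> n m k g f; have [[t [ht ->]] [s [hs ->]]] := (eh_arrP g, eh_arrP f).
  by rewrite eh_arrM !eh_relE.
- move=> n m f; have [t [ht ->]] := eh_arrP f.
  by rewrite eh_liftE !eh_relE eh_sem_shift.
- by move=> n; exact: eh_relE.
- by move=> n; exact: eh_relE.
- by move=> n; exact: eh_relE.
- by move=> n; exact: eh_relE.
Defined.

End EFHstrands.

Lemma EFH_Gen : isomorphic EFH Gen.
Proof. exact: strands_iso EFH_strands. Qed.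

Theorem mainTheorem2 :
  isomorphic EF EFH /\ isomorphic EFH Gen /\ isomorphic EF Gen.
Proof.
split; first exact: isomorphic_trans EF_Gen (isomorphic_sym EFH_Gen).
by split; [exact: EFH_Gen | exact: EF_Gen].
Qed.
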